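(* For every integer $d\ge2$, the set $\eta(\mathcal O_d)$ is a semialgebraic subset of $\mathbb R^{3d}$; consequently $\mathcal O_d$ has only finitely many path components.
   Context: A polynomial knot is a map $\phi:\mathbb R\to\mathbb R^3$ with real polynomial components which is a smooth embedding ($\phi$ injective and $\phi'(t)\ne0$ for all $t$). For $d\ge2$, $\mathcal A_d$ is the set of polynomial maps $t\mapsto(f(t),g(t),h(t))$ with $\deg f\le d-2$, $\deg g\le d-1$, $\deg h\le d$, and $\eta:\mathcal A_d\to\mathbb R^{3d}$ is the bijection $(f,g,h)\mapsto(a_0,\dots,a_{d-2},b_0,\dots,b_{d-1},c_0,\dots,c_d)$, where $f=\sum a_it^i$, $g=\sum b_it^i$, $h=\sum c_it^i$; $\mathcal A_d$ carries the topology making $\eta$ a homeomorphism onto Euclidean $\mathbb R^{3d}$. $\mathcal O_d$ is the subspace of polynomial knots in $\mathcal A_d$. A subset of $\mathbb R^n$ is semialgebraic if it belongs to the smallest class of subsets containing all sets $\{P=0\}$ and $\{P>0\}$ for real polynomials $P$ in $n$ variables and closed under finite unions, finite intersections and complements. *)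

(* Defs.v *)
From Stdlib Require Import Reals List.
Import ListNotations.
Open Scope R_scope.

(** * Points of R^n are lists of reals of length n. *)

Inductive mpoly : Type :=
| PConst : R -> mpoly
| PVar : nat -> mpoly
| PAdd : mpoly -> mpoly -> mpoly
| PMul : mpoly -> mpoly -> mpoly
| POpp : mpoly -> mpoly.

Fixpoint mpoly_eval (x : list R) (P : mpoly) : R :=
  match P with
  | PConst c => c
  | PVar i => nth i x 0
  | PAdd P Q => mpoly_eval x P + mpoly_eval x Q
  | PMul P Q => mpoly_eval x P * mpoly_eval x Q
  | POpp P => - mpoly_eval x P
  end.

Inductive sa_formula : Type :=
| SAEq0 : mpoly -> sa_formula
| SAGt0 : mpoly -> sa_formula
| SAOr : sa_formula -> sa_formula -> sa_formula
| SAAnd : sa_formula -> sa_formula -> sa_formula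
| SANot : sa_formula -> sa_formula.

Fixpoint sa_holds (x : list R) (F : sa_formula) : Prop :=
  match F with
  | SAEq0 P => mpoly_eval x P = 0
  | SAGt0 P => mpoly_eval x P > 0
  | SAOr F G => sa_holds x F \/ sa_holds x G
  | SAAnd F G => sa_holds x F /\ sa_holds x G
  | SANot F => ~ sa_holds x F
  end.

(** A subset S of R^n is semialgebraic iff it belongs to the smallest class
    of subsets of R^n containing the {P=0}, {P>0} and closed under finite
    unions, finite intersections and complements (in R^n), i.e. iff it is
    the set described by a boolean combination of such basic sets. *)
Definition semialgebraic (n : nat) (S : list R -> Prop) : Prop :=
  (forall x, S x -> length x = n) /\
  exists F : sa_formula, forall x, length x = n -> (S x <-> sa_holds x F).

Fixpoint upoly_eval (c : list R) (t : R) : R :=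
  match c with
  | [] => 0
  | a :: c' => a + t * upoly_eval c' t
  end.

Record polymap := PolyMap { pf : list R; pg : list R; ph : list R }.

(** Membership in A_d: deg f <= d-2, deg g <= d-1, deg h <= d, i.e. exactly
    d-1, d, d+1 coefficients (possibly zero). *)
Definition in_A (d : nat) (p : polymap) : Prop :=
  length (pf p) = (d - 1)%nat /\ length (pg p) = d /\ length (ph p) = S d.

Definition eta (p : polymap) : list R := pf p ++ pg p ++ ph p.

Definition phi (p : polymap) (t : R) : R * R * R :=
  (upoly_eval (pf p) t, upoly_eval (pg p) t, upoly_eval (ph p) t).

Definition is_poly_knot (p : polymap) : Prop :=
  (forall s t, phi p s = phi p t -> s = t) /\
  (forall t, exists l1 l2 l3,
      derivable_pt_lim (upoly_eval (pf p)) t l1 /\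
      derivable_pt_lim (upoly_eval (pg p)) t l2 /\
      derivable_pt_lim (upoly_eval (ph p)) t l3 /\
      ~ (l1 = 0 /\ l2 = 0 /\ l3 = 0)).

Definition in_O (d : nat) (p : polymap) : Prop := in_A d p /\ is_poly_knot p.

Definition eta_O (d : nat) (v : list R) : Prop :=
  exists p, in_O d p /\ eta p = v.

Definition cont_on_01 (n : nat) (gamma : R -> list R) : Prop :=
  forall i, (i < n)%nat ->
  forall s, 0 <= s <= 1 -> forall eps, eps > 0 ->
  exists delta, delta > 0 /\
    forall s', 0 <= s' <= 1 -> Rabs (s' - s) < delta ->
      Rabs (nth i (gamma s') 0 - nth i (gamma s) 0) < eps.

Definition path_connected_in (n : nat) (S : list R -> Prop) (x y : list R) : Prop :=
  exists gamma : R -> list R,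
    cont_on_01 n gamma /\
    (forall s, 0 <= s <= 1 -> S (gamma s)) /\
    gamma 0 = x /\ gamma 1 = y.

Definition finitely_many_path_components (n : nat) (S : list R -> Prop) : Prop :=
  exists L : list (list R),
    (forall z, In z L -> S z) /\
    forall x, S x -> exists z, In z L /\ path_connected_in n S x z.

(* Main.v *)
Require Import Defs.
From Stdlib Require Import Reals List Lra Lia Classical ClassicalEpsilon.
From mathcomp Require ssreflect ssrfun ssrbool eqtype ssrnat seq ssralg ssrnum
  ordered_qelim qe_rcf Rstruct.
Import ListNotations.

(** Being a knot is a first-order condition on the coefficients, so quantifier elimination makes
    [eta_O d] semialgebraic.  A semialgebraic set has finitely many path components because
    [R^n] is, for any finite family of polynomials, a finite union of path-connected sets on
    which the family has constant signs.  This goes by induction on [n], projecting along the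
    first coordinate [y].  Close the family under d/dy: every root in [y] of a member is then a
    _simple_ root of some member.  Simple roots persist under perturbation, so on a set where the
    number of simple roots of each member is constant, the i-th simple root is a continuous
    function of the remaining coordinates (no condition on degrees, and no control of complex
    roots, is needed).  If moreover the order of all these root functions is constant on a
    path-connected set, its paths lift to the cells obtained by prescribing the position of [y]
    relative to each root function. *)

(** * Projections of semialgebraic sets *)

(** The conditions imposed on a base set (which root functions exist, how they are ordered, which
    polynomials vanish along them) quantify over the fibre coordinate. The induction therefore
    concerns families of definable predicates rather than families of polynomials: quantifier
    elimination turns the conditions back into sign conditions in one variable fewer, in the place
    of the resultant computations of the classical construction. Two phenomena shape the treatment
    of roots. A multiple root may split or disappear under perturbation, so only simple roots are
    followed, and multiple ones are reached through derivatives. A root may also come in from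
    infinity where a leading coefficient vanishes. Either way the number of simple roots can only
    increase near a point, and prescribing that number on a base set excludes both. *)

Module TarskiSeidenberg.
Import ssreflect ssrfun ssrbool eqtype ssrnat seq ssralg ssrnum ordered_qelim qe_rcf Rstruct.
Import GRing.Theory Num.Theory.
Local Open Scope nat_scope.

Lemma nth_list_seq (x : list R) i : List.nth i x 0%R = seq.nth (0%R : R) x i.
Proof. by elim: x i => [|a x IH] [|i] //=. Qed.

(** [GRing.Inv] gets an arbitrary value: [rterm] excludes it, and eliminating quantifiers from a
    formula without inverses introduces none. *)
Fixpoint mpoly_of_term (t : GRing.term R) : mpoly :=
  match t with
  | GRing.Var i => PVar i
  | GRing.Const c => PConst c
  | GRing.NatConst n => PConst (n%:R)%R
  | GRing.Add u v => PAdd (mpoly_of_term u) (mpoly_of_term v)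
  | GRing.Opp u => POpp (mpoly_of_term u)
  | GRing.NatMul u n => PMul (PConst (n%:R)%R) (mpoly_of_term u)
  | GRing.Mul u v => PMul (mpoly_of_term u) (mpoly_of_term v)
  | GRing.Inv u => PConst 0
  | GRing.Exp u n => Nat.iter n (PMul (mpoly_of_term u)) (PConst 1)
  end.

Lemma mpoly_of_termE (e : list R) (t : GRing.term R) :
  GRing.rterm t -> mpoly_eval e (mpoly_of_term t) = GRing.eval e t.
Proof.
elim: t => //=.
- by move=> i _; rewrite nth_list_seq.
- by move=> u IHu v IHv /andP[/IHu -> /IHv ->].
- by move=> u IHu /IHu ->.
- by move=> u IHu n /IHu ->; rewrite -[RHS]mulr_natl.
- by move=> u IHu v IHv /andP[/IHu -> /IHv ->].
- move=> u IHu n /IHu Eu; elim: n => [|n IHn] //=.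
  by rewrite IHn Eu exprS.
Qed.

(** The last case catches quantifiers and unit tests, which [qf_form] and [rformula] exclude. *)
Fixpoint sa_of_formula (f : ord.formula R) : sa_formula :=
  match f with
  | ord.Bool true => SAEq0 (PConst 0)
  | ord.Bool false => SAGt0 (PConst 0)
  | ord.Equal t u => SAEq0 (PAdd (mpoly_of_term t) (POpp (mpoly_of_term u)))
  | ord.Lt t u => SAGt0 (PAdd (mpoly_of_term u) (POpp (mpoly_of_term t)))
  | ord.Le t u => SANot (SAGt0 (PAdd (mpoly_of_term t) (POpp (mpoly_of_term u))))
  | ord.And f g => SAAnd (sa_of_formula f) (sa_of_formula g)
  | ord.Or f g => SAOr (sa_of_formula f) (sa_of_formula g)
  | ord.Implies f g => SAOr (SANot (sa_of_formula f)) (sa_of_formula g)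
  | ord.Not f => SANot (sa_of_formula f)
  | _ => SAGt0 (PConst 0)
  end.

Lemma sa_of_formulaP (e : list R) (f : ord.formula R) :
  ord.qf_form f -> ord.rformula f -> sa_holds e (sa_of_formula f) <-> ord.qf_eval e f.
Proof.
elim: f => //=.
- by case=> _ _ /=; split=> //; lra.
- move=> t u _ /andP[rt ru]; rewrite !mpoly_of_termE //.
  split=> [h|/eqP ->]; last by rewrite Rplus_opp_r.
  by apply/eqP; apply: Rminus_diag_uniq.
- move=> t u _ /andP[rt ru]; rewrite !mpoly_of_termE //.
  move: (GRing.eval e t) (GRing.eval e u) => a b.
  by split=> [h|/RltP h]; [apply/RltP|]; lra.
- move=> t u _ /andP[rt ru]; rewrite !mpoly_of_termE //.
  move: (GRing.eval e t) (GRing.eval e u) => a b.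
  by split=> [h|/RleP h]; [apply/RleP|]; lra.
- move=> f IHf g IHg /andP[qf qg] /andP[rf rg].
  by rewrite IHf // IHg //; split=> [[-> ->]|/andP].
- move=> f IHf g IHg /andP[qf qg] /andP[rf rg].
  by rewrite IHf // IHg //; split=> /orP.
- move=> f IHf g IHg /andP[qf qg] /andP[rf rg].
  rewrite IHf // IHg // implybE.
  by split=> [[/negP ->|->]|/orP[/negP|]]; rewrite ?orbT //; [left|right].
- by move=> f IHf qf rf; rewrite IHf //; split=> /negP.
Qed.

(* The head coordinate becomes the variable ['X_m]; with [m] past all variables of the tail,
   quantifying it does not shift the others. *)
Fixpoint term_of_mpoly (m : nat) (P : mpoly) : GRing.term R :=
  match P with
  | PConst c => GRing.Const c
  | PVar i => GRing.Var _ (if i is j.+1 then j else m)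
  | PAdd P Q => GRing.Add (term_of_mpoly m P) (term_of_mpoly m Q)
  | PMul P Q => GRing.Mul (term_of_mpoly m P) (term_of_mpoly m Q)
  | POpp P => GRing.Opp (term_of_mpoly m P)
  end.

Fixpoint mpoly_var_bound (P : mpoly) : nat :=
  match P with
  | PConst _ => 0
  | PVar i => i
  | PAdd P Q | PMul P Q => maxn (mpoly_var_bound P) (mpoly_var_bound Q)
  | POpp P => mpoly_var_bound P
  end.

Lemma term_of_mpoly_rterm m P : GRing.rterm (term_of_mpoly m P).
Proof. by elim: P => //= P -> Q ->. Qed.

Lemma term_of_mpolyE m P y (x : list R) : mpoly_var_bound P <= m ->
  GRing.eval (set_nth (0%R : R) x m y) (term_of_mpoly m P) = mpoly_eval (y :: x) P.
Proof.
elim: P => //=.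
- case=> [|j] /= jm; rewrite nth_set_nth /= ?eqxx //.
  by rewrite (negbTE (_ : j != m)) ?neq_ltn ?jm // nth_list_seq.
- by move=> P IHP Q IHQ; rewrite geq_max => /andP[/IHP -> /IHQ ->].
- by move=> P IHP Q IHQ; rewrite geq_max => /andP[/IHP -> /IHQ ->].
- by move=> P IHP /IHP ->.
Qed.

Fixpoint formula_of_sa (m : nat) (F : sa_formula) : ord.formula R :=
  match F with
  | SAEq0 P => ord.Equal (term_of_mpoly m P) (GRing.Const (0%R : R))
  | SAGt0 P => ord.Lt (GRing.Const (0%R : R)) (term_of_mpoly m P)
  | SAOr F G => ord.Or (formula_of_sa m F) (formula_of_sa m G)
  | SAAnd F G => ord.And (formula_of_sa m F) (formula_of_sa m G)
  | SANot F => ord.Not (formula_of_sa m F)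
  end.

Fixpoint sa_var_bound (F : sa_formula) : nat :=
  match F with
  | SAEq0 P | SAGt0 P => mpoly_var_bound P
  | SAOr F G | SAAnd F G => maxn (sa_var_bound F) (sa_var_bound G)
  | SANot F => sa_var_bound F
  end.

Lemma formula_of_sa_rformula m F : ord.rformula (formula_of_sa m F).
Proof.
elim: F => //=; try by move=> P; rewrite term_of_mpoly_rterm.
- by move=> F -> G ->.
- by move=> F -> G ->.
Qed.

Lemma formula_of_saP m F y (x : list R) : sa_var_bound F <= m ->
  ord.holds (set_nth (0%R : R) x m y) (formula_of_sa m F) <-> sa_holds (y :: x) F.
Proof.
elim: F => /=.
- by move=> P /term_of_mpolyE ->.
- by move=> P /term_of_mpolyE ->; split=> [/RltP|] h; [|apply/RltP].
- by move=> F IHF G IHG; rewrite geq_max => /andP[/IHF -> /IHG ->].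
- by move=> F IHF G IHG; rewrite geq_max => /andP[/IHF -> /IHG ->].
- by move=> F IHF /IHF ->.
Qed.

(** Tarski-Seidenberg, from quantifier elimination over the real closed field [R]. Absent
    coordinates read as zero on both sides, so the equivalence holds for lists of every length. *)
Theorem projection (F : sa_formula) : exists G : sa_formula,
  forall x, sa_holds x G <-> exists y, sa_holds (y :: x) F.
Proof.
pose m := sa_var_bound F.
pose f := ord.Exists m (formula_of_sa m F).
have rf : ord.rformula f by apply: formula_of_sa_rformula.
have /andP[qg rg] := ord.quantifier_elim_wf (@wf_QE_wproj R) rf.
exists (sa_of_formula (ord.quantifier_elim (@wproj R) f)) => x.
rewrite sa_of_formulaP //.
have P := ord.quantifier_elim_rformP (@wf_QE_wproj R) (@valid_QE_wproj R) x rf.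
have Fm y := @formula_of_saP m F y x (leqnn _).
split=> [/P|] [y] hy.
- by exists y; apply/Fm.
- by apply/P; exists y; apply/Fm.
Qed.
End TarskiSeidenberg.

(** * Definable sets and the space of knots *)

Definition polynomial_function (f : list R -> R) : Prop :=
  exists P, forall x, f x = mpoly_eval x P.

(** No dimension is fixed: one formula serves lists of every length, and a bound variable can be
    pushed in front of any of them. *)
Definition definable (S : list R -> Prop) : Prop :=
  exists F, forall x, S x <-> sa_holds x F.

Lemma pf_mpoly P : polynomial_function (fun x => mpoly_eval x P).
Proof. now exists P. Qed.

Lemma pf_const c : polynomial_function (fun _ => c).
Proof. now exists (PConst c). Qed.

Lemma pf_nth i : polynomial_function (fun x => nth i x 0).
Proof. now exists (PVar i). Qed.

Lemma pf_add f g : polynomial_function f -> polynomial_function g ->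
  polynomial_function (fun x => f x + g x).
Proof. intros [P HP] [Q HQ]. exists (PAdd P Q). intros x. simpl. now rewrite HP, HQ. Qed.

Lemma pf_mul f g : polynomial_function f -> polynomial_function g ->
  polynomial_function (fun x => f x * g x).
Proof. intros [P HP] [Q HQ]. exists (PMul P Q). intros x. simpl. now rewrite HP, HQ. Qed.

Lemma pf_sub f g : polynomial_function f -> polynomial_function g ->
  polynomial_function (fun x => f x - g x).
Proof.
  intros [P HP] [Q HQ]. exists (PAdd P (POpp Q)). intros x. simpl. now rewrite HP, HQ.
Qed.

Definition pf_list (g : list R -> list R) : Prop :=
  forall i, polynomial_function (fun x => nth i (g x) 0).

Lemma pf_comp f (g : list R -> list R) :
  pf_list g ->
  polynomial_function f -> polynomial_function (fun x => f (g x)).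
Proof.
  intros Hg [P HP].
  assert (H : exists Q, forall x, mpoly_eval (g x) P = mpoly_eval x Q).
  { clear HP. induction P as [c|i|P [P' HP'] Q [Q' HQ']|P [P' HP'] Q [Q' HQ']|P [P' HP']].
    - now exists (PConst c).
    - apply Hg.
    - exists (PAdd P' Q'). intros x. simpl. now rewrite HP', HQ'.
    - exists (PMul P' Q'). intros x. simpl. now rewrite HP', HQ'.
    - exists (POpp P'). intros x. simpl. now rewrite HP'. }
  destruct H as [Q HQ]. exists Q. intros x. now rewrite HP, HQ.
Qed.

(* A list [cs] of functions of a point encodes a polynomial in one further variable. *)
Definition upoly_at (cs : list (list R -> R)) (x : list R) : R -> R :=
  upoly_eval (map (fun c => c x) cs).

Lemma pf_upoly_at cs g t : Forall polynomial_function cs ->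
  pf_list g -> polynomial_function t ->
  polynomial_function (fun x => upoly_at cs (g x) (t x)).
Proof.
  intros Hcs Hg Ht. unfold upoly_at. induction Hcs as [|c cs Hc Hcs IH]; simpl.
  - apply pf_const.
  - apply pf_add; [now apply pf_comp|now apply pf_mul].
Qed.

Lemma definable_ext S T : (forall x, S x <-> T x) -> definable S -> definable T.
Proof. intros H [F HF]. exists F. intros x. rewrite <- H. apply HF. Qed.

Lemma definable_eq f g : polynomial_function f -> polynomial_function g ->
  definable (fun x => f x = g x).
Proof.
  intros Hf Hg. destruct (pf_sub _ _ Hf Hg) as [P HP]. exists (SAEq0 P).
  intros x. simpl. rewrite <- HP. lra.
Qed.

Lemma definable_lt f g : polynomial_function f -> polynomial_function g ->
  definable (fun x => f x < g x).
Proof.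
  intros Hf Hg. destruct (pf_sub _ _ Hg Hf) as [P HP]. exists (SAGt0 P).
  intros x. simpl. rewrite <- HP. lra.
Qed.

Lemma definable_not S : definable S -> definable (fun x => ~ S x).
Proof. intros [F HF]. exists (SANot F). intros x. simpl. now rewrite HF. Qed.

Lemma definable_and S T : definable S -> definable T -> definable (fun x => S x /\ T x).
Proof. intros [F HF] [G HG]. exists (SAAnd F G). intros x. simpl. now rewrite HF, HG. Qed.

Lemma definable_or S T : definable S -> definable T -> definable (fun x => S x \/ T x).
Proof. intros [F HF] [G HG]. exists (SAOr F G). intros x. simpl. now rewrite HF, HG. Qed.

Lemma definable_impl S T : definable S -> definable T -> definable (fun x => S x -> T x).
Proof.
  intros HS HT. apply (definable_ext (fun x => ~ S x \/ T x)).
  - intros x. tauto.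
  - now apply definable_or; [apply definable_not|].
Qed.

Lemma definable_const (p : Prop) : definable (fun _ => p).
Proof.
  destruct (classic p) as [H|H].
  - exists (SAEq0 (PConst 0)). simpl. tauto.
  - exists (SAGt0 (PConst 0)). simpl. intros _. split; [tauto|lra].
Qed.

(** Bound variables are handled in de Bruijn style: the innermost one is the head of the list, the
    surrounding point its tail. *)
Lemma definable_ex (B : list R -> R -> Prop) :
  definable (fun e => B (tl e) (hd 0 e)) -> definable (fun x => exists y, B x y).
Proof.
  intros [F HF]. destruct (TarskiSeidenberg.projection F) as [G HG]. exists G.
  intros x. rewrite HG. split; intros [y Hy]; exists y; now apply (HF (y :: x)).
Qed.

Lemma definable_all (B : list R -> R -> Prop) :
  definable (fun e => B (tl e) (hd 0 e)) -> definable (fun x => forall y, B x y).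
Proof.
  intros H. apply (definable_ext (fun x => ~ exists y, ~ B x y)).
  - intros x. split.
    + intros Hx y. apply NNPP. intros Hy. apply Hx. now exists y.
    + intros Hx [y Hy]. now apply Hy.
  - now apply definable_not, definable_ex, definable_not.
Qed.

Lemma pf_hd : polynomial_function (hd 0).
Proof. exists (PVar 0). now intros [|y x]. Qed.

Lemma pf_list_id : pf_list (fun x => x).
Proof. intros i. apply pf_nth. Qed.

Lemma pf_tail : pf_list (@tl R).
Proof. intros i. exists (PVar (S i)). intros [|y x]; simpl; [now destruct i|reflexivity]. Qed.

Lemma pf_tl f : polynomial_function f -> polynomial_function (fun x => f (tl x)).
Proof. now apply (pf_comp f (@tl R) pf_tail). Qed.

Lemma pf_list_tl g : pf_list g -> pf_list (fun x => g (tl x)).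
Proof. intros Hg i. now apply (pf_tl (fun x => nth i (g x) 0)). Qed.

(** * Formal derivatives of coefficient lists *)

Definition ladd {A : Type} (add : A -> A -> A) : list A -> list A -> list A :=
  fix loop l m := match l, m with
  | [], _ => m
  | _, [] => l
  | a :: l', b :: m' => add a b :: loop l' m'
  end.

(** The rule [(a + t c)' = c + t c']. Stated for any type of coefficients, it applies to reals and
    to functions of a point, and evaluation at the point carries one to the other. Sending
    singletons to the empty list makes each derivative of a nonempty list shorter by one, on which
    an induction relies later. *)
Fixpoint lderiv {A : Type} (add : A -> A -> A) (zero : A) (l : list A) : list A :=
  match l with
  | [] | [_] => []
  | _ :: l' => ladd add l' (zero :: lderiv add zero l')
  end.

Definition uderiv : list R -> list R := lderiv Rplus 0.

Lemma upoly_eval_add c c' t :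
  upoly_eval (ladd Rplus c c') t = upoly_eval c t + upoly_eval c' t.
Proof.
  revert c'. induction c as [|a c IH]; intros [|b c']; simpl; try lra.
  rewrite IH. lra.
Qed.

Lemma upoly_eval_deriv_cons a c t :
  upoly_eval (uderiv (a :: c)) t = upoly_eval c t + t * upoly_eval (uderiv c) t.
Proof.
  unfold uderiv. destruct c as [|b c]; [simpl; lra|].
  change (lderiv Rplus 0 (a :: b :: c)) with (ladd Rplus (b :: c) (0 :: lderiv Rplus 0 (b :: c))).
  rewrite upoly_eval_add. simpl. lra.
Qed.

Lemma upoly_derivative c t :
  derivable_pt_lim (upoly_eval c) t (upoly_eval (uderiv c) t).
Proof.
  induction c as [|a c IH].
  - apply derivable_pt_lim_const.
  - rewrite upoly_eval_deriv_cons.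
    replace (_ + _) with (0 + (1 * upoly_eval c t + t * upoly_eval (uderiv c) t)) by ring.
    apply (derivable_pt_lim_plus (fun _ => a) (fun t => t * upoly_eval c t)).
    + apply derivable_pt_lim_const.
    + apply (derivable_pt_lim_mult id (upoly_eval c)); [apply derivable_pt_lim_id|exact IH].
Qed.

Lemma map_ladd {A B : Type} (f : A -> B) add add' l m :
  (forall a b, f (add a b) = add' (f a) (f b)) ->
  map f (ladd add l m) = ladd add' (map f l) (map f m).
Proof.
  intros H. revert m. induction l as [|a l IH]; intros [|b m]; simpl; try easy.
  now rewrite H, IH.
Qed.

Lemma map_lderiv {A B : Type} (f : A -> B) add add' zero zero' l :
  (forall a b, f (add a b) = add' (f a) (f b)) -> f zero = zero' ->
  map f (lderiv add zero l) = lderiv add' zero' (map f l).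
Proof.
  intros H H0. induction l as [|a [|b l] IH]; [easy|easy|].
  change (map f (ladd add (b :: l) (zero :: lderiv add zero (b :: l)))
    = ladd add' (map f (b :: l)) (zero' :: lderiv add' zero' (map f (b :: l)))).
  rewrite (map_ladd f add add') by exact H. now rewrite <- IH, <- H0.
Qed.

Lemma ladd_pf l m : Forall polynomial_function l -> Forall polynomial_function m ->
  Forall polynomial_function (ladd (fun f g x => f x + g x) l m).
Proof.
  intros Hl. revert m. induction Hl as [|f l Hf Hl IH]; intros m Hm; [exact Hm|].
  destruct Hm as [|g m Hg Hm]; simpl; constructor; auto. now apply pf_add.
Qed.

Lemma Forall_lderiv cs : Forall polynomial_function cs ->
  Forall polynomial_function (lderiv (fun f g x => f x + g x) (fun _ => 0) cs).
Proof.
  induction 1 as [|f l Hf Hl IH]; [constructor|]. destruct l as [|g l]; [constructor|].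
  apply ladd_pf; [exact Hl|]. constructor; [apply pf_const|exact IH].
Qed.

(** * The knot conditions in coordinates *)

Definition coordinates (a m : nat) : list (list R -> R) :=
  map (fun i x => nth i x 0) (seq a m).

Lemma coordinates_app u v w :
  map (fun c => c (u ++ v ++ w)) (coordinates (length u) (length v)) = v.
Proof.
  unfold coordinates. rewrite map_map.
  revert u. induction v as [|b v IH]; intros u; simpl; [reflexivity|]. f_equal.
  - rewrite app_nth2, Nat.sub_diag by lia. reflexivity.
  - specialize (IH (u ++ [b])). rewrite <- app_assoc, length_app, Nat.add_1_r in IH.
    exact IH.
Qed.

Lemma Forall_coordinates a m : Forall polynomial_function (coordinates a m).
Proof. apply Forall_map, Forall_forall. intros i _. apply pf_nth. Qed.

Definition pderiv : list (list R -> R) -> list (list R -> R) :=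
  lderiv (fun f g x => f x + g x) (fun _ => 0).

Lemma upoly_at_derivative cs x t :
  derivable_pt_lim (upoly_at cs x) t (upoly_at (pderiv cs) x t).
Proof.
  unfold upoly_at, pderiv.
  rewrite (map_lderiv (fun c : list R -> R => c x) _ Rplus _ 0) by easy.
  apply upoly_derivative.
Qed.

(** Limits are unique, so the derivatives in the immersion condition can only be the values of the
    formal derivatives. This makes the condition first-order. *)
Lemma is_poly_knot_iff f g h x :
  is_poly_knot (PolyMap (map (fun c => c x) f) (map (fun c => c x) g) (map (fun c => c x) h)) <->
  (forall s t, upoly_at f x s = upoly_at f x t /\ upoly_at g x s = upoly_at g x t /\
     upoly_at h x s = upoly_at h x t -> s = t) /\
  (forall t, ~ (upoly_at (pderiv f) x t = 0 /\ upoly_at (pderiv g) x t = 0 /\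
     upoly_at (pderiv h) x t = 0)).
Proof.
  unfold is_poly_knot, phi. simpl. fold (upoly_at f x) (upoly_at g x) (upoly_at h x).
  split; intros [Hinj Himm]; (split; [intros s t Hst|intros t]).
  - apply Hinj. destruct Hst as (-> & -> & ->). reflexivity.
  - destruct (Himm t) as (l1 & l2 & l3 & H1 & H2 & H3 & H).
    rewrite (uniqueness_limite _ _ _ _ H1 (upoly_at_derivative f x t)) in H.
    rewrite (uniqueness_limite _ _ _ _ H2 (upoly_at_derivative g x t)) in H.
    now rewrite (uniqueness_limite _ _ _ _ H3 (upoly_at_derivative h x t)) in H.
  - apply Hinj. injection Hst. auto.
  - do 3 eexists. do 3 (split; [apply upoly_at_derivative|]). apply Himm.
Qed.

Lemma definable_poly_knot f g h : Forall polynomial_function f ->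
  Forall polynomial_function g -> Forall polynomial_function h ->
  definable (fun x => is_poly_knot
    (PolyMap (map (fun c => c x) f) (map (fun c => c x) g) (map (fun c => c x) h))).
Proof.
  intros Hf Hg Hh. eapply definable_ext; [intros x; symmetry; apply is_poly_knot_iff|].
  (* Under the two binders of injectivity the list is [t :: s :: x]: the second entry is [s], and
     coefficients are read from [tl (tl _)]. *)
  assert (H2 : pf_list (fun x : list R => tl (tl x))) by exact (pf_list_tl _ pf_tail).
  assert (Hs : polynomial_function (fun x => hd 0 (tl x))).
  { apply (pf_tl (hd 0)), pf_hd. }
  apply definable_and.
  - do 2 apply definable_all. apply definable_impl; [|now apply definable_eq, pf_hd].
    apply definable_and; [|apply definable_and];
      (apply definable_eq; apply pf_upoly_at; auto using pf_hd).
  - apply definable_all, definable_not.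
    apply definable_and; [|apply definable_and];
      (apply definable_eq; [apply pf_upoly_at|apply pf_const]);
      auto using pf_hd, pf_tail, Forall_lderiv.
Qed.

(** The blocks start at [0], [d - 1] and [d - 1 + d]; with truncated subtraction their lengths add
    up to [3 * d] because [d] is positive. *)
Lemma eta_O_iff d x : (2 <= d)%nat -> eta_O d x <-> length x = (3 * d)%nat /\
  is_poly_knot (PolyMap (map (fun c => c x) (coordinates 0 (d - 1)))
    (map (fun c => c x) (coordinates (d - 1) d))
    (map (fun c => c x) (coordinates (d - 1 + d) (S d)))).
Proof.
  intros Hd.
  assert (Hsplit : forall f g h,
    length f = (d - 1)%nat -> length g = d -> length h = S d ->
    map (fun c => c (f ++ g ++ h)) (coordinates 0 (d - 1)) = f /\
    map (fun c => c (f ++ g ++ h)) (coordinates (d - 1) d) = g /\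
    map (fun c => c (f ++ g ++ h)) (coordinates (d - 1 + d) (S d)) = h).
  { intros f g h <- <- <-. repeat split.
    - exact (coordinates_app [] f (g ++ h)).
    - apply coordinates_app.
    - pose proof (coordinates_app (f ++ g) h []) as E.
      now rewrite app_nil_r, length_app, <- app_assoc in E. }
  split.
  - intros [[f g h] [[(Hf & Hg & Hh) HK] <-]]. unfold eta. simpl pf in *; simpl pg in *; simpl ph in *.
    split; [rewrite !length_app; lia|].
    destruct (Hsplit f g h Hf Hg Hh) as (-> & -> & ->). exact HK.
  - intros [Hx HK].
    set (f := firstn (d - 1) x). set (g := firstn d (skipn (d - 1) x)).
    set (h := skipn d (skipn (d - 1) x)).
    assert (Hfgh : x = f ++ g ++ h).
    { unfold f, g, h. now rewrite !firstn_skipn. }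
    assert (Hf : length f = (d - 1)%nat) by (apply firstn_length_le; lia).
    assert (Hg : length g = d) by (apply firstn_length_le; rewrite length_skipn; lia).
    assert (Hh : length h = S d) by (unfold h; rewrite !length_skipn; lia).
    clearbody f g h. subst x. destruct (Hsplit f g h Hf Hg Hh) as (E1 & E2 & E3).
    rewrite E1, E2, E3 in HK. exists (PolyMap f g h).
    split; [split; [now repeat split|exact HK]|reflexivity].
Qed.

Lemma eta_O_formula d : (2 <= d)%nat ->
  exists F, forall x, length x = (3 * d)%nat -> (eta_O d x <-> sa_holds x F).
Proof.
  intros Hd. destruct (definable_poly_knot (coordinates 0 (d - 1))
    (coordinates (d - 1) d) (coordinates (d - 1 + d) (S d))) as [F HF];
    try apply Forall_coordinates.
  exists F. intros x Hx. rewrite eta_O_iff, HF by easy. tauto.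
Qed.

(** * Persistence of simple roots *)

(** Covers neighbourhoods of a point ([nbhd]) and of a time within the unit interval ([time_nbhd]),
    so that the limit rules are proved once for both. *)
Definition is_filter {A : Type} (F : (A -> Prop) -> Prop) : Prop :=
  F (fun _ => True) /\
  (forall P Q : A -> Prop, F P -> F Q -> F (fun a => P a /\ Q a)) /\
  (forall P Q : A -> Prop, (forall a, P a -> Q a) -> F P -> F Q).

Lemma filter_univ {A} (F : (A -> Prop) -> Prop) (P : A -> Prop) :
  is_filter F -> (forall a, P a) -> F P.
Proof. intros (H & _ & Hm) HP. apply (Hm (fun _ => True)); auto. Qed.

Lemma filter_and2 {A} (F : (A -> Prop) -> Prop) (P Q S : A -> Prop) :
  is_filter F -> F P -> F Q -> (forall a, P a -> Q a -> S a) -> F S.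
Proof.
  intros (_ & Ha & Hm) HP HQ H. apply (Hm (fun a => P a /\ Q a)); [|now apply Ha].
  intros a [H1 H2]. now apply H.
Qed.

Lemma filter_mono {A} (F : (A -> Prop) -> Prop) (P Q : A -> Prop) :
  is_filter F -> F P -> (forall a, P a -> Q a) -> F Q.
Proof. intros (_ & _ & Hm) HP H. now apply (Hm P). Qed.

Definition tends {A : Type} (F : (A -> Prop) -> Prop) (f : A -> R) (l : R) : Prop :=
  forall eps, eps > 0 -> F (fun a => Rabs (f a - l) < eps).

Lemma tends_const {A} (F : (A -> Prop) -> Prop) c : is_filter F -> tends F (fun _ => c) c.
Proof.
  intros HF eps Heps. apply filter_univ; [exact HF|]. intros _.
  rewrite Rminus_diag, Rabs_R0. exact Heps.
Qed.

Lemma tends_add {A} (F : (A -> Prop) -> Prop) f g l m : is_filter F ->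
  tends F f l -> tends F g m -> tends F (fun a => f a + g a) (l + m).
Proof.
  intros HF Hf Hg eps Heps.
  apply (filter_and2 F _ _ _ HF (Hf (eps / 2) ltac:(lra)) (Hg (eps / 2) ltac:(lra))).
  intros a H1 H2. apply Rabs_def2 in H1, H2. apply Rabs_def1; lra.
Qed.

Lemma tends_opp {A} (F : (A -> Prop) -> Prop) f l : is_filter F ->
  tends F f l -> tends F (fun a => - f a) (- l).
Proof.
  intros HF Hf eps Heps. apply (filter_mono F _ _ HF (Hf eps Heps)).
  intros a H. apply Rabs_def2 in H. apply Rabs_def1; lra.
Qed.

Lemma tends_mul {A} (F : (A -> Prop) -> Prop) f g l m : is_filter F ->
  tends F f l -> tends F g m -> tends F (fun a => f a * g a) (l * m).
Proof.
  intros HF Hf Hg eps Heps.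
  pose proof (Rabs_pos l) as Hl. pose proof (Rabs_pos m) as Hm.
  (* As [e <= 1], the three error terms are bounded by [e e + |l| e + |m| e <= e K <= eps]. *)
  set (K := 1 + Rabs l + Rabs m).
  assert (HK : K > 0) by (unfold K; lra).
  set (e := Rmin 1 (eps / K)).
  assert (He : e > 0) by (apply Rmin_glb_lt; [lra|now apply Rdiv_lt_0_compat]).
  assert (He1 : e <= 1) by apply Rmin_l.
  assert (HeK : e * K <= eps).
  { apply Rle_trans with (eps / K * K); [|right; field; lra].
    apply Rmult_le_compat_r; [lra|apply Rmin_r]. }
  apply (filter_and2 F _ _ _ HF (Hf e He) (Hg e He)). intros a H1 H2.
  replace (f a * g a - l * m)
    with ((f a - l) * (g a - m) + (l * (g a - m) + (f a - l) * m)) by ring.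
  pose proof (Rabs_pos (f a - l)). pose proof (Rabs_pos (g a - m)).
  eapply Rle_lt_trans; [apply Rabs_triang|].
  eapply Rle_lt_trans; [apply Rplus_le_compat_l, Rabs_triang|].
  rewrite !Rabs_mult. unfold K in HeK. nra.
Qed.

Lemma tends_max {A} (F : (A -> Prop) -> Prop) f g l m : is_filter F ->
  tends F f l -> tends F g m -> tends F (fun a => Rmax (f a) (g a)) (Rmax l m).
Proof.
  intros HF Hf Hg eps Heps.
  apply (filter_and2 F _ _ _ HF (Hf eps Heps) (Hg eps Heps)).
  intros a H1 H2. apply Rabs_def2 in H1, H2. unfold Rmax.
  destruct (Rle_dec (f a) (g a)), (Rle_dec l m); apply Rabs_def1; lra.
Qed.

Lemma tends_min {A} (F : (A -> Prop) -> Prop) f g l m : is_filter F ->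
  tends F f l -> tends F g m -> tends F (fun a => Rmin (f a) (g a)) (Rmin l m).
Proof.
  intros HF Hf Hg eps Heps.
  apply (filter_and2 F _ _ _ HF (Hf eps Heps) (Hg eps Heps)).
  intros a H1 H2. apply Rabs_def2 in H1, H2. unfold Rmin.
  destruct (Rle_dec (f a) (g a)), (Rle_dec l m); apply Rabs_def1; lra.
Qed.

Lemma tends_polynomial {A} (F : (A -> Prop) -> Prop) (g : A -> list R) x0 f :
  is_filter F -> polynomial_function f ->
  (forall i, tends F (fun a => nth i (g a) 0) (nth i x0 0)) ->
  tends F (fun a => f (g a)) (f x0).
Proof.
  intros HF [P HP] Hg.
  assert (H : tends F (fun a => mpoly_eval (g a) P) (mpoly_eval x0 P)).
  { clear HP. induction P; simpl.
    - now apply tends_const.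
    - apply Hg.
    - now apply tends_add.
    - now apply tends_mul.
    - now apply tends_opp. }
  intros eps Heps. apply (filter_mono F _ _ HF (H eps Heps)).
  intros a. now rewrite !HP.
Qed.

Definition nbhd (x0 : list R) (P : list R -> Prop) : Prop :=
  exists delta, delta > 0 /\
    forall x, (forall i, Rabs (nth i x 0 - nth i x0 0) < delta) -> P x.

Lemma nbhd_filter x0 : is_filter (nbhd x0).
Proof.
  split; [|split].
  - exists 1. split; [lra|auto].
  - intros P Q [d [Hd HP]] [d' [Hd' HQ]]. exists (Rmin d d').
    split; [now apply Rmin_glb_lt|]. intros x Hx.
    split; [apply HP|apply HQ]; intros i; specialize (Hx i).
    + pose proof (Rmin_l d d'). lra.
    + pose proof (Rmin_r d d'). lra.
  - intros P Q H [d [Hd HP]]. exists d. auto.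
Qed.

Lemma nbhd_tends x0 f : polynomial_function f -> tends (nbhd x0) f (f x0).
Proof.
  intros Hf. apply (tends_polynomial (nbhd x0) (fun x => x)); [apply nbhd_filter|exact Hf|].
  intros i eps Heps. exists eps. split; [exact Heps|]. auto.
Qed.

(** * Simple roots and their ranks *)

Definition simple_root (q : list (list R -> R)) (x : list R) (y : R) : Prop :=
  upoly_at q x y = 0 /\ upoly_at (pderiv q) x y <> 0.

Lemma upoly_at_continuity q x : continuity (upoly_at q x).
Proof.
  intros t. apply derivable_continuous_pt.
  exists (upoly_at (pderiv q) x t). apply upoly_at_derivative.
Qed.

(** Difference quotients within [|l|] of [l] have the sign of [l], while the increment changes sign
    across [y]; hence [f] does too. *)
Lemma derivative_sign_change f y l r : derivable_pt_lim f y l -> f y = 0 -> l <> 0 -> r > 0 ->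
  exists h, 0 < h < r /\ f (y - h) * f (y + h) < 0.
Proof.
  intros Hd Hy Hl Hr.
  destruct (Hd (Rabs l) (Rabs_pos_lt l Hl)) as [[d Hdpos] Hdel]. simpl in Hdel.
  exists (Rmin d r / 2).
  assert (Hm : 0 < Rmin d r) by now apply Rmin_glb_lt.
  pose proof (Rmin_l d r). pose proof (Rmin_r d r).
  set (h := Rmin d r / 2). assert (0 < h < r /\ h < d) as [Hh Hhd] by (unfold h; lra).
  split; [exact Hh|].
  assert (H1 := Hdel h ltac:(lra) ltac:(rewrite Rabs_right; lra)).
  assert (H2 := Hdel (- h) ltac:(lra) ltac:(rewrite Rabs_left; lra)).
  rewrite Hy, Rminus_0_r in H1, H2. change (y + - h) with (y - h) in H2.
  set (a := f (y + h) / h) in *. set (b := f (y - h) / - h) in *.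
  assert (E1 : f (y + h) = a * h) by (unfold a; field; lra).
  assert (E2 : f (y - h) = b * - h) by (unfold b; field; lra).
  rewrite E1, E2.
  assert (Hab : 0 < a * b).
  { apply Rabs_def2 in H1, H2. revert H1 H2. unfold Rabs. destruct (Rcase_abs l); nra. }
  assert (Hhh : 0 < h * h) by nra.
  replace (b * - h * (a * h)) with (- ((a * b) * (h * h))) by ring.
  pose proof (Rmult_lt_0_compat _ _ Hab Hhh). lra.
Qed.

Lemma tends_same_sign {A} (F : (A -> Prop) -> Prop) f l : is_filter F ->
  tends F f l -> l <> 0 -> F (fun a => 0 < f a * l).
Proof.
  intros HF Hf Hl. apply (filter_mono F _ _ HF (Hf (Rabs l) (Rabs_pos_lt l Hl))).
  intros a Ha. apply Rabs_def2 in Ha. revert Ha. unfold Rabs. destruct (Rcase_abs l); nra.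
Qed.

(** The sign change of [q] across [y0] survives a small change of [x], and the intermediate value
    theorem gives a root. It is simple because the derivative, jointly continuous in [y] and [x],
    stays nonzero near [(y0, x0)]; [h] is taken below the radius [d] where this holds. *)
Lemma simple_root_persists q x0 y0 eps : Forall polynomial_function q ->
  simple_root q x0 y0 -> eps > 0 ->
  nbhd x0 (fun x => exists y, Rabs (y - y0) < eps /\ simple_root q x y).
Proof.
  intros Hq [H0 H1] Heps.
  pose (D := fun e => upoly_at (pderiv q) (tl e) (hd 0 e)).
  assert (HD : polynomial_function D).
  { apply pf_upoly_at; [now apply Forall_lderiv|apply pf_tail|apply pf_hd]. }
  destruct (nbhd_tends (y0 :: x0) D HD _ (Rabs_pos_lt _ H1)) as [d [Hd HDd]].
  destruct (derivative_sign_change (upoly_at q x0) y0 _ (Rmin d eps)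
    (upoly_at_derivative q x0 y0) H0 H1 ltac:(now apply Rmin_glb_lt)) as [h [Hh Hs]].
  pose proof (Rmin_l d eps). pose proof (Rmin_r d eps).
  assert (Hpf : forall y, polynomial_function (fun x => upoly_at q x y)).
  { intros y. apply (pf_upoly_at q (fun x => x)); [exact Hq|apply pf_list_id|apply pf_const]. }
  assert (Hne : upoly_at q x0 (y0 - h) <> 0 /\ upoly_at q x0 (y0 + h) <> 0) by nra.
  pose proof (tends_same_sign _ _ _ (nbhd_filter x0) (nbhd_tends x0 _ (Hpf (y0 - h))) (proj1 Hne)) as N1.
  pose proof (tends_same_sign _ _ _ (nbhd_filter x0) (nbhd_tends x0 _ (Hpf (y0 + h))) (proj2 Hne)) as N2.
  assert (N3 : nbhd x0 (fun x => forall i, Rabs (nth i x 0 - nth i x0 0) < d)).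
  { exists d. auto. }
  apply (filter_and2 _ _ _ _ (nbhd_filter x0) N3
    (proj1 (proj2 (nbhd_filter x0)) _ _ N1 N2)).
  intros x Hx [S1 S2].
  destruct (IVT_cor (upoly_at q x) (y0 - h) (y0 + h)) as [y [Hy Hy0]].
  - apply upoly_at_continuity.
  - lra.
  - set (a := upoly_at q x (y0 - h)) in *. set (b := upoly_at q x (y0 + h)) in *.
    set (a0 := upoly_at q x0 (y0 - h)) in *. set (b0 := upoly_at q x0 (y0 + h)) in *.
    assert (0 < (a * a0) * (b * b0)) by now apply Rmult_lt_0_compat.
    apply Rnot_lt_le. intros Hab. assert (0 < (a * b) * - (a0 * b0)) by nra. nra.
  - exists y. assert (Hyy : Rabs (y - y0) < d /\ Rabs (y - y0) < eps)
      by (split; apply Rabs_def1; lra).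
    split; [apply Hyy|]. split; [exact Hy0|]. intros Hc.
    specialize (HDd (y :: x)). unfold D in HDd. simpl in HDd. rewrite Hc in HDd.
    assert (Hlt : Rabs (0 - upoly_at (pderiv q) x0 y0) < Rabs (upoly_at (pderiv q) x0 y0)).
    { apply HDd. intros [|i]; simpl; [apply Hyy|apply Hx]. }
    rewrite Rminus_0_l, Rabs_Ropp in Hlt. lra.
Qed.

(* At least [k] simple roots lie below [b]. *)
Fixpoint roots_below (q : list (list R -> R)) (k : nat) (x : list R) (b : R) : Prop :=
  match k with
  | O => True
  | S k' => exists z, z < b /\ simple_root q x z /\ roots_below q k' x z
  end.

(** Ranks start at zero. Counting by chains instead of cardinalities keeps the predicate
    first-order, hence definable. *)
Definition nth_root (q : list (list R -> R)) (i : nat) (x : list R) (y : R) : Prop :=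
  simple_root q x y /\ roots_below q i x y /\ ~ roots_below q (S i) x y.

Lemma roots_below_le q k x b b' : b <= b' -> roots_below q k x b -> roots_below q k x b'.
Proof.
  destruct k as [|k]; [easy|]. intros Hb (z & Hz & H). exists z. split; [lra|exact H].
Qed.

Lemma roots_below_open q k x b : roots_below q k x b -> exists b', b' < b /\ roots_below q k x b'.
Proof.
  destruct k as [|k]; simpl.
  - intros _. exists (b - 1). split; [lra|easy].
  - intros (z & Hz & H). exists ((z + b) / 2). split; [lra|]. exists z. split; [lra|exact H].
Qed.

(** Lower semicontinuity of the number of simple roots. The rest of the chain already lies below
    some [z' < z], which leaves [z] room to move without crossing [z'] or [b]. *)
Lemma roots_below_persists q k x0 b : Forall polynomial_function q ->
  roots_below q k x0 b -> nbhd x0 (fun x => roots_below q k x b).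
Proof.
  intros Hq. revert b. induction k as [|k IH]; intros b Hb.
  - apply filter_univ; [apply nbhd_filter|easy].
  - destruct Hb as (z & Hz & Hs & Hk).
    destruct (roots_below_open _ _ _ _ Hk) as (z' & Hz' & Hk').
    apply (filter_and2 _ _ _ _ (nbhd_filter x0) (IH z' Hk')
      (simple_root_persists q x0 z (Rmin (z - z') (b - z)) Hq Hs
        ltac:(apply Rmin_glb_lt; lra))).
    intros x H1 (y & Hy & Hsy). exists y.
    pose proof (Rmin_l (z - z') (b - z)). pose proof (Rmin_r (z - z') (b - z)).
    apply Rabs_def2 in Hy. split; [lra|]. split; [exact Hsy|].
    apply (roots_below_le q k x z'); [lra|exact H1].
Qed.

Lemma nth_root_unique q i x y y' : nth_root q i x y -> nth_root q i x y' -> y = y'.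
Proof.
  assert (H : forall y y', nth_root q i x y -> nth_root q i x y' -> ~ y < y').
  { intros z z' (Hs & Hi & _) (_ & _ & Hn) Hlt. apply Hn. now exists z. }
  intros H1 H2. pose proof (H _ _ H1 H2). pose proof (H _ _ H2 H1). lra.
Qed.

(** * Bounds on the number of roots *)

Lemma upoly_division c r : c <> [] -> exists q, length q = pred (length c) /\
  forall t, upoly_eval c t = (t - r) * upoly_eval q t + upoly_eval c r.
Proof.
  induction c as [|a c IH]; intros H; [easy|]. clear H. destruct c as [|b c].
  - exists []. split; [easy|]. intros t. simpl. ring.
  - destruct IH as (q & Hq & E); [easy|].
    (* Horner's scheme: the remainder of the tail becomes the constant coefficient of the
       quotient. *)
    exists (upoly_eval (b :: c) r :: q). split; [simpl in *; lia|].
    intros t. change (upoly_eval (a :: b :: c) ?s) with (a + s * upoly_eval (b :: c) s).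
    rewrite (E t). simpl. ring.
Qed.

Lemma upoly_many_roots l c : NoDup l -> (length c <= length l)%nat ->
  (forall r, In r l -> upoly_eval c r = 0) -> forall t, upoly_eval c t = 0.
Proof.
  revert c. induction l as [|r l IH]; intros c Hl Hlen Hr t.
  - destruct c; [reflexivity|simpl in Hlen; lia].
  - destruct c as [|a c]; [reflexivity|].
    destruct (upoly_division (a :: c) r) as (q & Hq & E); [easy|].
    inversion_clear Hl as [|? ? Hnr Hl'].
    rewrite E, (Hr r (or_introl eq_refl)), (IH q Hl'); [ring|simpl in *; lia|].
    intros s Hs. pose proof (E s) as Es.
    rewrite (Hr s (or_intror Hs)), (Hr r (or_introl eq_refl)) in Es.
    assert (s - r <> 0) by (intros H; apply Hnr; now replace r with s by lra). nra.
Qed.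

Lemma roots_below_list q k x b : roots_below q k x b ->
  exists l, length l = k /\ NoDup l /\ forall r, In r l -> r < b /\ upoly_at q x r = 0.
Proof.
  revert b. induction k as [|k IH]; intros b.
  - intros _. exists []. split; [reflexivity|]. split; [constructor|contradiction].
  - intros (z & Hz & Hs & Hk). destruct (IH z Hk) as (l & Hl & Hn & H).
    exists (z :: l). split; [simpl; lia|]. split.
    + constructor; [|exact Hn]. intros Hin. destruct (H z Hin). lra.
    + intros r [<-|Hr]; [split; [exact Hz|apply Hs]|]. destruct (H r Hr). split; [lra|easy].
Qed.

(** Otherwise [q] has at least as many roots as coefficients, so it vanishes identically and its
    derivative at [b] is zero. Counting coefficients rather than the degree makes the bound uniform
    in [x]. *)
Lemma roots_below_length q k x b : simple_root q x b -> roots_below q k x b -> (k < length q)%nat.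
Proof.
  intros [H0 H1] Hk. destruct (Nat.lt_ge_cases k (length q)) as [H|H]; [exact H|exfalso].
  destruct (roots_below_list _ _ _ _ Hk) as (l & Hl & Hn & Hr).
  apply H1. apply (uniqueness_limite (upoly_at q x) b); [apply upoly_at_derivative|].
  intros eps Heps. exists (mkposreal 1 Rlt_0_1). intros h Hh _. unfold upoly_at.
  rewrite !(upoly_many_roots l); try assumption.
  - unfold Rdiv. rewrite Rminus_diag, Rmult_0_l, Rminus_diag, Rabs_R0. exact Heps.
  - rewrite length_map. lia.
  - intros r Hin. apply (Hr r Hin).
  - rewrite length_map. lia.
  - intros r Hin. apply (Hr r Hin).
Qed.

Lemma nth_root_length q i x y : nth_root q i x y -> (i < length q)%nat.
Proof. intros (Hs & Hi & _). now apply (roots_below_length q i x y). Qed.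

Lemma simple_root_index q k x y : simple_root q x y -> roots_below q k x y ->
  exists i, (k <= i)%nat /\ nth_root q i x y.
Proof.
  intros Hs. remember (length q - k)%nat as m eqn:Hm. revert k Hm.
  induction m as [|m IH]; intros k Hm Hk; pose proof (roots_below_length _ _ _ _ Hs Hk).
  - lia.
  - destruct (classic (roots_below q (S k) x y)) as [H'|H'].
    + destruct (IH (S k)) as (i & Hi & H1); [lia|exact H'|]. exists i. split; [lia|exact H1].
    + exists k. split; [lia|]. exact (conj Hs (conj Hk H')).
Qed.

Lemma nth_root_pred q i x y : nth_root q (S i) x y -> exists z, nth_root q i x z.
Proof.
  intros (Hs & (z & Hz & Hsz & Hiz) & Hn). exists z. split; [exact Hsz|]. split; [exact Hiz|].
  intros H. apply Hn. now exists z.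
Qed.

(** The ranks that occur form an initial segment: [y] has some rank at least [k], and every root of
    positive rank has a predecessor. *)
Lemma nth_root_exists q k x y : simple_root q x y -> roots_below q k x y ->
  exists z, nth_root q k x z.
Proof.
  intros Hs Hk. destruct (simple_root_index _ _ _ _ Hs Hk) as (i & Hi & H).
  clear Hs Hk. revert y H. induction Hi as [|i Hi IH]; intros y H; [now exists y|].
  destruct (nth_root_pred _ _ _ _ H) as (z & Hz). now apply (IH z).
Qed.

(* The number of simple roots can only jump up nearby; being constant on [C], it forces the
   [i]-th simple root near [x] to be the one persisting from [x0]. *)
Lemma nth_root_persists q (C : list R -> Prop) : Forall polynomial_function q ->
  (forall i x x', C x -> C x' ->
    (exists y, nth_root q i x y) -> exists y, nth_root q i x' y) ->
  forall i x0 y0 eps, C x0 -> nth_root q i x0 y0 -> eps > 0 ->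
  nbhd x0 (fun x => C x -> exists y, Rabs (y - y0) < eps /\ nth_root q i x y).
Proof.
  (* Downward induction on the rank: the root following [y0], if there is one, is already known to
     persist with its rank. *)
  intros Hq HC i. remember (length q - i)%nat as m eqn:Hm. revert i Hm.
  induction m as [|m IH]; intros i Hm x0 y0 eps HC0 H0 Heps;
    pose proof (nth_root_length _ _ _ _ H0); [lia|].
  destruct H0 as (Hs & Hi & Hn). pose proof (nbhd_filter x0) as HF.
  destruct (roots_below_open _ _ _ _ Hi) as (b & Hb & Hib).
  pose proof (roots_below_persists q i x0 b Hq Hib) as N1.
  assert (Hlow : forall x y, roots_below q i x b -> Rabs (y - y0) < y0 - b ->
    roots_below q i x y).
  { intros x y Hx Hy. apply Rabs_def2 in Hy. apply (roots_below_le q i x b); [lra|exact Hx]. }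
  destruct (classic (exists z0, nth_root q (S i) x0 z0)) as [[z0 Hz0]|Hno].
  - assert (Hyz : y0 < z0).
    { apply Rnot_le_lt. intros Hle. apply Hn. apply (roots_below_le q (S i) x0 z0); [exact Hle|].
      apply Hz0. }
    (* The bound [y0 - b] keeps [i] roots below the new root; half the gap keeps the roots near [y0]
       and near [z0] in disjoint intervals. *)
    set (e := Rmin eps (Rmin (y0 - b) ((z0 - y0) / 2))).
    assert (He : e > 0) by (repeat apply Rmin_glb_lt; lra).
    assert (He1 : e <= eps) by apply Rmin_l.
    assert (He2 : e <= y0 - b /\ e <= (z0 - y0) / 2).
    { pose proof (Rmin_r eps (Rmin (y0 - b) ((z0 - y0) / 2))).
      pose proof (Rmin_l (y0 - b) ((z0 - y0) / 2)).
      pose proof (Rmin_r (y0 - b) ((z0 - y0) / 2)). unfold e. lra. }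
    apply (filter_and2 _ _ _ _ HF N1 (proj1 (proj2 HF) _ _
      (simple_root_persists q x0 y0 e Hq Hs He)
      (IH (S i) ltac:(lia) x0 z0 e HC0 Hz0 He))).
    intros x H1 [(y & Hy & Hsy) H3] HCx. destruct (H3 HCx) as (z & Hz & Hrz).
    exists y. split; [lra|]. split; [exact Hsy|]. split; [apply Hlow; [exact H1|lra]|].
    (* With [S i] roots below [y], appending [y] would put one too many below [z], whose rank is
       [S i]. *)
    intros Hc. apply Hrz. apply Rabs_def2 in Hy, Hz. exists y. split; [lra|]. now split.
  - set (e := Rmin eps (y0 - b)).
    assert (He : e > 0) by (apply Rmin_glb_lt; lra).
    assert (He1 : e <= eps) by apply Rmin_l.
    assert (He2 : e <= y0 - b) by apply Rmin_r.
    apply (filter_and2 _ _ _ _ HF N1 (simple_root_persists q x0 y0 e Hq Hs He)).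
    intros x H1 (y & Hy & Hsy) HCx. exists y.
    split; [lra|]. split; [exact Hsy|]. split; [apply Hlow; [exact H1|lra]|].
    (* One more root below [y] would produce a root of rank [S i] over [x], and by constancy over
       [x0]. *)
    intros Hc. apply Hno. apply (HC (S i) x x0 HCx HC0).
    now apply (nth_root_exists q (S i) x y).
Qed.

Lemma length_pderiv q : length (pderiv q) = pred (length q).
Proof.
  assert (Hadd : forall l m : list (list R -> R),
    length (ladd (fun f g x => f x + g x) l m) = Nat.max (length l) (length m)).
  { induction l as [|a l IH]; intros [|b m]; simpl; try lia. now rewrite IH. }
  induction q as [|a [|b q] IH]; [reflexivity|reflexivity|].
  etransitivity; [apply Hadd|].
  change (Nat.max (S (length q)) (S (length (pderiv (b :: q)))) = S (length q)).
  rewrite IH. simpl. lia.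
Qed.

Lemma Forall_pderiv_iter k q : Forall polynomial_function q ->
  Forall polynomial_function (Nat.iter k pderiv q).
Proof. intros Hq. induction k; [exact Hq|]. now apply Forall_lderiv. Qed.

(* A root of multiplicity [m] is a simple root of the [m-1]-st derivative. *)
Lemma root_simple_of_derivative q x y : upoly_at q x y = 0 ->
  (exists t, upoly_at q x t <> 0) ->
  exists k, (k < length q)%nat /\ simple_root (Nat.iter k pderiv q) x y.
Proof.
  remember (length q) as m eqn:Hm. revert q Hm. induction m as [|m IH]; intros q Hm H0 [t Ht].
  - destruct q; [|easy]. now elim Ht.
  - destruct (classic (upoly_at (pderiv q) x y = 0)) as [H1|H1].
    + destruct (IH (pderiv q)) as (k & Hk & Hs).
      * rewrite length_pderiv. lia.
      * exact H1.
      (* If the derivative vanished identically, [q] would be constant, equal to its value zero at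
         [y]. *)
      * apply NNPP. intros Hno. apply Ht. rewrite <- H0.
        assert (pr : derivable (upoly_at q x)).
        { intros s. exists (upoly_at (pderiv q) x s). apply upoly_at_derivative. }
        apply (null_derivative_1 _ pr). intros s. apply derive_pt_eq_0.
        replace 0 with (upoly_at (pderiv q) x s); [apply upoly_at_derivative|].
        apply NNPP. intros Hs. apply Hno. now exists s.
      * exists (S k). split; [lia|]. now rewrite Nat.iter_succ_r.
    + exists 0%nat. split; [lia|]. now split.
Qed.

(** * Paths *)

Definition time_nbhd (s : R) (P : R -> Prop) : Prop :=
  exists delta, delta > 0 /\ forall s', 0 <= s' <= 1 -> Rabs (s' - s) < delta -> P s'.

Definition continuous01 (u : R -> R) : Prop :=
  forall s, 0 <= s <= 1 -> tends (time_nbhd s) u (u s).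

Lemma time_nbhd_filter s : is_filter (time_nbhd s).
Proof.
  split; [|split].
  - exists 1. split; [lra|auto].
  - intros P Q [d [Hd HP]] [d' [Hd' HQ]]. exists (Rmin d d').
    split; [now apply Rmin_glb_lt|]. intros x Hx Hlt.
    pose proof (Rmin_l d d'). pose proof (Rmin_r d d').
    split; [apply HP|apply HQ]; lra.
  - intros P Q H [d [Hd HP]]. exists d. auto.
Qed.

Lemma continuous01_const c : continuous01 (fun _ => c).
Proof. intros s _. apply tends_const, time_nbhd_filter. Qed.

Lemma continuous01_id : continuous01 (fun s => s).
Proof. intros s _ eps Heps. exists eps. auto. Qed.

Lemma continuous01_add u v : continuous01 u -> continuous01 v -> continuous01 (fun s => u s + v s).
Proof. intros Hu Hv s Hs. apply tends_add; auto using time_nbhd_filter. Qed.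

Lemma continuous01_sub u v : continuous01 u -> continuous01 v -> continuous01 (fun s => u s - v s).
Proof. intros Hu Hv s Hs. apply tends_add; auto using time_nbhd_filter, tends_opp. Qed.

Lemma continuous01_mul u v : continuous01 u -> continuous01 v -> continuous01 (fun s => u s * v s).
Proof. intros Hu Hv s Hs. apply tends_mul; auto using time_nbhd_filter. Qed.

Lemma continuous01_max u v : continuous01 u -> continuous01 v ->
  continuous01 (fun s => Rmax (u s) (v s)).
Proof. intros Hu Hv s Hs. apply tends_max; auto using time_nbhd_filter. Qed.

Lemma continuous01_min u v : continuous01 u -> continuous01 v ->
  continuous01 (fun s => Rmin (u s) (v s)).
Proof. intros Hu Hv s Hs. apply tends_min; auto using time_nbhd_filter. Qed.

(** * Continuous interpolation between finitely many bounds *)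

Definition fold_min (d : R -> R) (us : list (R -> R)) (s : R) : R :=
  fold_right (fun u m => Rmin (u s) m) (d s) us.

Definition fold_max (d : R -> R) (us : list (R -> R)) (s : R) : R :=
  fold_right (fun u m => Rmax (u s) m) (d s) us.

Lemma fold_min_continuous d us : continuous01 d -> Forall continuous01 us ->
  continuous01 (fold_min d us).
Proof. intros Hd. induction 1; [exact Hd|]. now apply continuous01_min. Qed.

Lemma fold_max_continuous d us : continuous01 d -> Forall continuous01 us ->
  continuous01 (fold_max d us).
Proof. intros Hd. induction 1; [exact Hd|]. now apply continuous01_max. Qed.

Lemma fold_min_le d us s :
  fold_min d us s <= d s /\ forall u, In u us -> fold_min d us s <= u s.
Proof.
  induction us as [|u us [IH1 IH2]]; simpl; [split; [lra|easy]|].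
  fold (fold_min d us s). pose proof (Rmin_l (u s) (fold_min d us s)).
  pose proof (Rmin_r (u s) (fold_min d us s)).
  split; [lra|]. intros v [<-|Hv]; [easy|]. specialize (IH2 v Hv). lra.
Qed.

Lemma fold_max_ge d us s :
  d s <= fold_max d us s /\ forall u, In u us -> u s <= fold_max d us s.
Proof.
  induction us as [|u us [IH1 IH2]]; simpl; [split; [lra|easy]|].
  fold (fold_max d us s). pose proof (Rmax_l (u s) (fold_max d us s)).
  pose proof (Rmax_r (u s) (fold_max d us s)).
  split; [lra|]. intros v [<-|Hv]; [easy|]. specialize (IH2 v Hv). lra.
Qed.

Lemma fold_min_glb d us s z : z < d s -> (forall u, In u us -> z < u s) -> z < fold_min d us s.
Proof.
  intros Hd. induction us as [|u us IH]; intros H; simpl; [exact Hd|].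
  apply Rmin_glb_lt; [apply H; now left|]. apply IH. intros v Hv. apply H. now right.
Qed.

Lemma fold_max_lub d us s z : d s < z -> (forall u, In u us -> u s < z) -> fold_max d us s < z.
Proof.
  intros Hd. induction us as [|u us IH]; intros H; simpl; [exact Hd|].
  apply Rmax_lub_lt; [apply H; now left|]. apply IH. intros v Hv. apply H. now right.
Qed.

Lemma barycentric lo hi z : lo < z < hi -> exists a, 0 < a < 1 /\ a * (hi - lo) = z - lo.
Proof.
  intros Hz. exists ((z - lo) / (hi - lo)).
  assert (E : (z - lo) / (hi - lo) * (hi - lo) = z - lo) by (field; lra).
  split; [|exact E].
  split; apply (Rmult_lt_reg_r (hi - lo)); rewrite ?E; lra.
Qed.

(** The function runs between a maximum [M] of the lower bounds and a minimum [U] of the upper ones,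
    at a relative height that moves linearly between the heights imposed at the two ends. *)
Lemma continuous_interpolation ls us y0 y1 :
  Forall continuous01 ls -> Forall continuous01 us ->
  (forall l u s, In l ls -> In u us -> 0 <= s <= 1 -> l s < u s) ->
  (forall l, In l ls -> l 0 < y0 /\ l 1 < y1) ->
  (forall u, In u us -> y0 < u 0 /\ y1 < u 1) ->
  exists y, continuous01 y /\ y 0 = y0 /\ y 1 = y1 /\
    forall s, 0 <= s <= 1 ->
      (forall l, In l ls -> l s < y s) /\ (forall u, In u us -> y s < u s).
Proof.
  intros Hls Hus Hlu Hl Hu.
  (* Artificial bounds make up for missing ones: [m - 1] lies below [y0], [y1] and all upper
     functions, so it can join the lower ones; the default in [U] lies above [M], [y0] and [y1]. *)
  set (m := fold_min (fun _ => Rmin y0 y1) us).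
  set (M := fold_max (fun s => m s - 1) ls).
  set (U := fold_min (fun s => Rmax (M s) (Rmax y0 y1) + 1) us).
  assert (Hm : continuous01 m) by (apply fold_min_continuous; [apply continuous01_const|easy]).
  assert (HM : continuous01 M).
  { apply fold_max_continuous; [|easy].
    apply continuous01_sub; [exact Hm|apply continuous01_const]. }
  assert (HU : continuous01 U).
  { apply fold_min_continuous; [|easy]. apply continuous01_add; [|apply continuous01_const].
    apply continuous01_max; [exact HM|apply continuous01_const]. }
  assert (HmM : forall s, m s <= Rmin y0 y1 /\ forall u, In u us -> m s <= u s)
    by (intros s; apply (fold_min_le (fun _ => Rmin y0 y1) us s)).
  pose proof (Rmin_l y0 y1) as Y1. pose proof (Rmin_r y0 y1) as Y2.
  pose proof (Rmax_l y0 y1) as Y3. pose proof (Rmax_r y0 y1) as Y4.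
  assert (HMU : forall s, 0 <= s <= 1 -> M s < U s).
  { intros s Hs. apply fold_min_glb.
    - pose proof (Rmax_l (M s) (Rmax y0 y1)). lra.
    - intros u Hin. apply fold_max_lub.
      + pose proof (proj2 (HmM s) u Hin). lra.
      + intros l Hinl. now apply Hlu. }
  assert (HM0 : M 0 < y0 /\ M 1 < y1).
  { split; apply fold_max_lub.
    - pose proof (proj1 (HmM 0)). lra.
    - intros l Hin. now apply Hl.
    - pose proof (proj1 (HmM 1)). lra.
    - intros l Hin. now apply Hl. }
  assert (HU0 : y0 < U 0 /\ y1 < U 1).
  { split; apply fold_min_glb.
    - pose proof (Rmax_r (M 0) (Rmax y0 y1)). lra.
    - intros u Hin. now apply Hu.
    - pose proof (Rmax_r (M 1) (Rmax y0 y1)). lra.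
    - intros u Hin. now apply Hu. }
  destruct (barycentric (M 0) (U 0) y0) as (a & Ha & Ea); [lra|].
  destruct (barycentric (M 1) (U 1) y1) as (b & Hb & Eb); [lra|].
  exists (fun s => M s + (a + s * (b - a)) * (U s - M s)). split; [|split; [|split]].
  - apply continuous01_add; [exact HM|]. apply continuous01_mul; [|now apply continuous01_sub].
    apply continuous01_add; [apply continuous01_const|].
    apply continuous01_mul; [apply continuous01_id|apply continuous01_const].
  - rewrite Rmult_0_l, Rplus_0_r, Ea. ring.
  - replace (a + 1 * (b - a)) with b by ring. rewrite Eb. ring.
  - intros s Hs. pose proof (HMU s Hs) as H.
    assert (Hc : 0 < a + s * (b - a) < 1).
    { destruct (Rle_dec a b).
      - assert (0 <= s * (b - a) <= b - a) by nra. lra.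
      - assert (0 <= s * (a - b) <= a - b) by nra. lra. }
    set (c := a + s * (b - a)) in *. clearbody c.
    assert (M s < M s + c * (U s - M s) < U s) by nra.
    split; intros v Hv.
    + pose proof (proj2 (fold_max_ge (fun s => m s - 1) ls s) v Hv). fold (M s) in H1. lra.
    + pose proof (proj2 (fold_min_le (fun s => Rmax (M s) (Rmax y0 y1) + 1) us s) v Hv) as H1.
      fold (U s) in H1. lra.
Qed.

Lemma ivt01 u : continuous01 u -> 0 < u 0 -> u 1 < 0 -> exists s, 0 <= s <= 1 /\ u s = 0.
Proof.
  (* Clamping extends [u] continuously to the whole line, where [IVT_cor] expects continuity. *)
  intros Hu H0 H1. set (clamp := fun s => Rmax 0 (Rmin 1 s)).
  assert (Hc : forall s, 0 <= clamp s <= 1).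
  { intros s. unfold clamp, Rmax, Rmin. destruct (Rle_dec 1 s), (Rle_dec 0 _); lra. }
  assert (Hid : forall s, 0 <= s <= 1 -> clamp s = s).
  { intros s Hs. unfold clamp, Rmax, Rmin.
    destruct (Rle_dec 1 s); destruct (Rle_dec 0 _); lra. }
  assert (Hlip : forall s t, Rabs (clamp s - clamp t) <= Rabs (s - t)).
  { intros s t. unfold clamp, Rmax, Rmin.
    destruct (Rle_dec 1 s), (Rle_dec 1 t); repeat destruct (Rle_dec 0 _);
      unfold Rabs; repeat destruct (Rcase_abs _); lra. }
  destruct (IVT_cor (fun s => u (clamp s)) 0 1) as [s [Hs Hs0]].
  - intros s eps Heps. destruct (Hu (clamp s) (Hc s) eps Heps) as [d [Hd H]].
    exists d. split; [exact Hd|]. intros t [_ Ht]. simpl in *. unfold Rdist in *.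
    apply H; [apply Hc|]. eapply Rle_lt_trans; [apply Hlip|exact Ht].
  - lra.
  - rewrite !Hid by lra. nra.
  - rewrite Hid in Hs0 by easy. now exists s.
Qed.

Lemma path_nbhd n gamma s P : cont_on_01 n gamma ->
  (forall s, 0 <= s <= 1 -> length (gamma s) = n) -> 0 <= s <= 1 ->
  nbhd (gamma s) P -> time_nbhd s (fun s' => P (gamma s')).
Proof.
  intros Hg Hlen Hs [d [Hd HP]].
  (* Each coordinate of a path comes with its own modulus; the induction on [k] finds a common one.
     Coordinates from [n] on read as zero. *)
  assert (H : forall k, (k <= n)%nat -> time_nbhd s (fun s' => forall i, (i < k)%nat ->
    Rabs (nth i (gamma s') 0 - nth i (gamma s) 0) < d)).
  { induction k as [|k IH]; intros Hk.
    - apply filter_univ; [apply time_nbhd_filter|]. intros s' i Hi. lia.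
    - apply (filter_and2 _ _ _ _ (time_nbhd_filter s) (IH ltac:(lia)) (Hg k ltac:(lia) s Hs d Hd)).
      intros s' H1 H2 i Hi. destruct (Nat.eq_dec i k) as [->|Hne]; [exact H2|].
      apply H1. lia. }
  destruct (H n (le_n n)) as [e [He Hn]]. exists e. split; [exact He|].
  intros s' Hs' Hlt. apply HP. intros i. destruct (Nat.lt_ge_cases i n) as [Hi|Hi].
  - now apply Hn.
  - rewrite !nth_overflow by (rewrite Hlen; assumption).
    rewrite Rminus_diag, Rabs_R0. exact Hd.
Qed.

Lemma continuous01_along_path n gamma f : cont_on_01 n gamma ->
  (forall s, 0 <= s <= 1 -> length (gamma s) = n) -> polynomial_function f ->
  continuous01 (fun s => f (gamma s)).
Proof.
  intros Hg Hlen Hf s Hs eps Heps.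
  now apply (path_nbhd n gamma s _ Hg Hlen Hs (nbhd_tends (gamma s) f Hf eps Heps)).
Qed.

Lemma cont_on_01_cons n y gamma : continuous01 y -> cont_on_01 n gamma ->
  cont_on_01 (S n) (fun s => y s :: gamma s).
Proof.
  intros Hy Hg [|i] Hi s Hs eps Heps; simpl.
  - now apply Hy.
  - apply Hg; [lia|easy|easy].
Qed.

(** The atoms of the Boolean algebra generated by [Ps]. Inconsistent choices of signs give empty
    cells, so a cell is described relative to one of its members. *)
Lemma separating_cells {A : Type} (Ps : list (A -> Prop)) : exists Ks : list (A -> Prop),
  (forall a, exists K, In K Ks /\ K a) /\
  (forall K, In K Ks -> forall a, K a -> forall b,
     K b <-> forall P, In P Ps -> (P a <-> P b)).
Proof.
  induction Ps as [|P Ps (Ks & Hcov & HK)].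
  - exists [fun _ => True]. split.
    + intros a. exists (fun _ => True). simpl. auto.
    + intros K [<-|[]] a _ b. simpl. tauto.
  - exists (map (fun K a => K a /\ P a) Ks ++ map (fun K a => K a /\ ~ P a) Ks). split.
    + intros a. destruct (Hcov a) as (K & HKin & HKa).
      destruct (classic (P a)) as [Ha|Ha].
      * exists (fun a => K a /\ P a). split; [|easy]. apply in_or_app. left.
        now apply (in_map (fun (K : A -> Prop) a => K a /\ P a)).
      * exists (fun a => K a /\ ~ P a). split; [|easy]. apply in_or_app. right.
        now apply (in_map (fun (K : A -> Prop) a => K a /\ ~ P a)).
    + intros K' Hin a Ha b. apply in_app_or in Hin.
      destruct Hin as [Hin|Hin]; apply in_map_iff in Hin; destruct Hin as (K & <- & HKin);
        destruct Ha as [Ha HPa]; rewrite (HK K HKin a Ha b); simpl; split.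
      * intros [H Hb] Q [<-|HQ]; [tauto|now apply H].
      * intros H. split; [intros Q HQ; apply H; now right|]. now apply (H P (or_introl eq_refl)).
      * intros [H Hb] Q [<-|HQ]; [tauto|now apply H].
      * intros H. split; [intros Q HQ; apply H; now right|].
        intros Hb. now apply HPa, (H P (or_introl eq_refl)).
Qed.

Definition path_connected (n : nat) (C : list R -> Prop) : Prop :=
  forall x x', C x -> C x' -> path_connected_in n C x x'.

Definition constant_on {A : Type} (C P : A -> Prop) : Prop :=
  forall x x', C x -> C x' -> P x -> P x'.

Definition decomposable (n : nat) (Ps : list (list R -> Prop)) : Prop :=
  exists Cs : list (list R -> Prop),
    (forall x, length x = n -> exists C, In C Cs /\ C x) /\
    forall C, In C Cs ->
      (forall x, C x -> length x = n) /\ path_connected n C /\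
      forall P, In P Ps -> constant_on C P.

(** * Cylindrical decomposition *)

Lemma definable_simple_root q g t : Forall polynomial_function q -> pf_list g ->
  polynomial_function t -> definable (fun e => simple_root q (g e) (t e)).
Proof.
  intros Hq Hg Ht. apply definable_and; [|apply definable_not];
    (apply definable_eq; [apply pf_upoly_at|apply pf_const]); auto.
  now apply Forall_lderiv.
Qed.

(** The substitutions [g] and [t] stay general because each root of the chain binds a new head
    variable and shifts the point by [tl]. *)
Lemma definable_roots_below q k g t : Forall polynomial_function q -> pf_list g ->
  polynomial_function t -> definable (fun e => roots_below q k (g e) (t e)).
Proof.
  intros Hq. revert g t. induction k as [|k IH]; intros g t Hg Ht.
  - apply (definable_const True).
  - apply definable_ex. apply definable_and; [|apply definable_and].
    + apply definable_lt; [apply pf_hd|now apply pf_tl].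
    + apply (definable_simple_root q (fun e => g (tl e)) (hd 0));
        [exact Hq|now apply pf_list_tl|apply pf_hd].
    + apply (IH (fun e => g (tl e)) (hd 0)); [now apply pf_list_tl|apply pf_hd].
Qed.

Lemma definable_nth_root q i g t : Forall polynomial_function q -> pf_list g ->
  polynomial_function t -> definable (fun e => nth_root q i (g e) (t e)).
Proof.
  intros Hq Hg Ht. apply definable_and; [now apply definable_simple_root|].
  apply definable_and; [|apply definable_not]; now apply definable_roots_below.
Qed.

Lemma upoly_at_cons c q x t : upoly_at (c :: q) x t = c x + t * upoly_at q x t.
Proof. reflexivity. Qed.

Lemma upoly_at_ladd l m x t :
  upoly_at (ladd (fun f g x => f x + g x) l m) x t = upoly_at l x t + upoly_at m x t.
Proof.
  unfold upoly_at. rewrite (map_ladd (fun c : list R -> R => c x) _ Rplus) by easy.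
  apply upoly_eval_add.
Qed.

Lemma upoly_at_scale f l x t :
  upoly_at (map (fun (g : list R -> R) x => f x * g x) l) x t = f x * upoly_at l x t.
Proof.
  induction l as [|g l IH]; [unfold upoly_at; simpl; ring|].
  simpl map. rewrite !upoly_at_cons, IH. ring.
Qed.

Lemma polynomial_in_first_variable f : polynomial_function f ->
  exists q, Forall polynomial_function q /\ forall y x, f (y :: x) = upoly_at q x y.
Proof.
  intros [P HP].
  cut (exists q, Forall polynomial_function q /\
    forall y x, mpoly_eval (y :: x) P = upoly_at q x y).
  { intros (q & Hq & E). exists q. split; [exact Hq|]. intros y x. now rewrite HP. }
  clear f HP. induction P as [c|[|i]|P [p [Hp Ep]] Q [q [Hq Eq]]|P [p [Hp Ep]] Q [q [Hq Eq]]|P [p [Hp Ep]]].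
  - exists [fun _ => c]. split; [repeat constructor; apply pf_const|].
    intros y x. unfold upoly_at. simpl. ring.
  - exists [fun _ => 0; fun _ => 1]. split; [repeat constructor; apply pf_const|].
    intros y x. unfold upoly_at. simpl. ring.
  - exists [fun x => nth i x 0]. split; [repeat constructor; apply pf_nth|].
    intros y x. unfold upoly_at. simpl. ring.
  - exists (ladd (fun f g x => f x + g x) p q). split; [now apply ladd_pf|].
    intros y x. simpl. now rewrite upoly_at_ladd, Ep, Eq.
  - cut (exists r, Forall polynomial_function r /\
      forall x y, upoly_at r x y = upoly_at p x y * upoly_at q x y).
    { intros (r & Hr & Er). exists r. split; [exact Hr|]. intros y x. simpl.
      now rewrite Er, Ep, Eq. }
    clear Ep Eq. induction Hp as [|f p Hf Hp [r [Hr Er]]].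
    + exists []. split; [constructor|]. intros x y. unfold upoly_at. simpl. ring.
    (* This is [(f + y p) q = f q + y (p q)]; multiplying by [y] prepends a zero coefficient. *)
    + exists (ladd (fun f g x => f x + g x) (map (fun (g : list R -> R) x => f x * g x) q)
        ((fun _ => 0) :: r)). split.
      * apply ladd_pf; [|constructor; [apply pf_const|exact Hr]].
        apply Forall_map. eapply Forall_impl; [|exact Hq]. intros g Hg. now apply pf_mul.
      * intros x y. rewrite upoly_at_ladd, upoly_at_scale, !upoly_at_cons, Er. ring.
  - exists (map (fun (g : list R -> R) x => -1 * g x) p). split.
    + apply Forall_map. eapply Forall_impl; [|exact Hp]. intros g Hg.
      apply (pf_mul (fun _ => -1)); [apply pf_const|exact Hg].
    + intros y x. rewrite (upoly_at_scale (fun _ => -1)). simpl. rewrite Ep. ring.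
Qed.

(** * Root functions and delineated base sets *)

Definition root_index : Type := (list (list R -> R) * nat)%type.

Definition has_root (r : root_index) (x : list R) : Prop :=
  exists y, nth_root (fst r) (snd r) x y.

Definition root_value (r : root_index) (x : list R) : R :=
  epsilon (inhabits 0) (nth_root (fst r) (snd r) x).

Lemma root_value_spec r x : has_root r x -> nth_root (fst r) (snd r) x (root_value r x).
Proof. apply epsilon_spec. Qed.

Lemma root_value_eq r x y : nth_root (fst r) (snd r) x y -> root_value r x = y.
Proof.
  intros H. apply (nth_root_unique (fst r) (snd r) x); [|exact H].
  apply root_value_spec. now exists y.
Qed.

(** Both ranges suffice: a root of a polynomial that is not identically zero is a simple root of a
    derivative of order below its number of coefficients, and ranks stay below the number of
    coefficients. *)
Definition root_indices (css : list (list (list R -> R))) : list root_index :=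
  flat_map (fun cs => flat_map (fun k => let q := Nat.iter k pderiv cs in
    map (pair q) (seq 0 (length q))) (seq 0 (length cs))) css.

Lemma in_root_indices css r : In r (root_indices css) <->
  exists cs k, In cs css /\ (k < length cs)%nat /\
    fst r = Nat.iter k pderiv cs /\ (snd r < length (fst r))%nat.
Proof.
  unfold root_indices. rewrite in_flat_map. split.
  - intros (cs & Hcs & H). apply in_flat_map in H. destruct H as (k & Hk & H).
    apply in_seq in Hk. apply in_map_iff in H. destruct H as (i & <- & Hi).
    apply in_seq in Hi. exists cs, k. simpl. repeat split; auto; lia.
  - intros (cs & k & Hcs & Hk & Hq & Hi). exists cs. split; [exact Hcs|].
    apply in_flat_map. exists k. split; [apply in_seq; lia|].
    apply in_map_iff. exists (snd r). rewrite <- Hq. split; [now destruct r|].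
    apply in_seq. lia.
Qed.

Lemma root_indices_pf css r : Forall (Forall polynomial_function) css ->
  In r (root_indices css) -> Forall polynomial_function (fst r).
Proof.
  intros Hcss Hr. apply in_root_indices in Hr. destruct Hr as (cs & k & Hcs & _ & -> & _).
  apply Forall_pderiv_iter. now apply (proj1 (Forall_forall _ css) Hcss).
Qed.

(** Two existing roots coincide when neither strict order holds, so [del_order] fixes coincidences
    as well. [del_zero] handles fibres where a polynomial vanishes identically: there its
    derivatives have no simple roots to detect its zeros. *)
Record delineated (n : nat) (css : list (list (list R -> R))) (C : list R -> Prop) : Prop := {
  del_length : forall x, C x -> length x = n;
  del_path : path_connected n C;
  del_root : forall r, In r (root_indices css) -> constant_on C (has_root r);
  del_order : forall r r', In r (root_indices css) -> In r' (root_indices css) ->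
    constant_on C (fun x => exists y y', y < y' /\
      nth_root (fst r) (snd r) x y /\ nth_root (fst r') (snd r') x y');
  del_vanish : forall cs r, In cs css -> In r (root_indices css) ->
    constant_on C (fun x => exists y, nth_root (fst r) (snd r) x y /\ upoly_at cs x y = 0);
  del_zero : forall cs, In cs css -> constant_on C (fun x => forall y, upoly_at cs x y = 0) }.

Lemma delineated_order n css C r r' x x' : delineated n css C ->
  In r (root_indices css) -> In r' (root_indices css) -> C x -> C x' ->
  has_root r x -> has_root r' x -> root_value r x < root_value r' x ->
  root_value r x' < root_value r' x'.
Proof.
  intros HC Hr Hr' Hx Hx' Hrx Hrx' Hlt.
  destruct (del_order n css C HC r r' Hr Hr' x x' Hx Hx') as (y & y' & Hy & H & H').
  - exists (root_value r x), (root_value r' x).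
    split; [exact Hlt|]. split; now apply root_value_spec.
  - now rewrite (root_value_eq _ _ _ H), (root_value_eq _ _ _ H').
Qed.

Lemma root_value_continuous n css C r x0 eps : Forall (Forall polynomial_function) css ->
  delineated n css C -> In r (root_indices css) -> C x0 -> has_root r x0 -> eps > 0 ->
  nbhd x0 (fun x => C x -> Rabs (root_value r x - root_value r x0) < eps).
Proof.
  intros Hcss HC Hr Hx0 Hroot Heps.
  (* Persistence asks for constancy at every rank; a rank that occurs is below the length, hence
     listed in [root_indices]. *)
  assert (Hconst : forall i x x', C x -> C x' ->
    (exists y, nth_root (fst r) i x y) -> exists y, nth_root (fst r) i x' y).
  { intros i x x' Hx Hx' Hy. apply (del_root n css C HC (fst r, i)) with x; auto.
    apply in_root_indices in Hr. destruct Hr as (cs & k & Hcs & Hk & Hq & _).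
    apply in_root_indices. exists cs, k. simpl. repeat split; auto.
    destruct Hy as [y Hy]. now apply nth_root_length in Hy. }
  apply (filter_mono _ _ _ (nbhd_filter x0)
    (nth_root_persists (fst r) C (root_indices_pf css r Hcss Hr) Hconst (snd r) x0
      (root_value r x0) eps Hx0 (root_value_spec r x0 Hroot) Heps)).
  intros x H Hx. destruct (H Hx) as (y & Hy & Hry). now rewrite (root_value_eq _ _ _ Hry).
Qed.

(** Lying on a root is encoded as being neither above nor below it, the existence of the root being
    constant over a delineated set. *)
Definition above_root (r : root_index) (e : list R) : Prop :=
  has_root r (tl e) /\ root_value r (tl e) < hd 0 e.

Definition below_root (r : root_index) (e : list R) : Prop :=
  has_root r (tl e) /\ hd 0 e < root_value r (tl e).

Definition same_position (css : list (list (list R -> R))) (e e' : list R) : Prop :=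
  forall r, In r (root_indices css) ->
    (above_root r e <-> above_root r e') /\ (below_root r e <-> below_root r e').

(** If [y0] is a root value, the lift follows that root function; otherwise it is interpolated
    between the root functions below and above [y0]. The constant order of root functions over [C]
    preserves the position. *)
Lemma lift_path n css C x0 y0 x1 y1 : Forall (Forall polynomial_function) css ->
  delineated n css C -> C x0 -> C x1 -> same_position css (y0 :: x0) (y1 :: x1) ->
  exists gamma : R -> list R, exists y : R -> R,
    cont_on_01 n gamma /\ continuous01 y /\
    (y 0 :: gamma 0 = y0 :: x0) /\ (y 1 :: gamma 1 = y1 :: x1) /\
    forall s, 0 <= s <= 1 ->
      C (gamma s) /\ same_position css (y0 :: x0) (y s :: gamma s).
Proof.
  intros Hcss HC Hx0 Hx1 Hpos.
  destruct (del_path n css C HC x0 x1 Hx0 Hx1) as (gamma & Hcont & HCg & G0 & G1).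
  exists gamma.
  assert (Hlen : forall s, 0 <= s <= 1 -> length (gamma s) = n).
  { intros s Hs. apply (del_length n css C HC). now apply HCg. }
  assert (Hroot : forall r x x', In r (root_indices css) -> C x -> C x' ->
    has_root r x -> has_root r x').
  { intros r x x' Hr. now apply (del_root n css C HC r Hr). }
  assert (Hval : forall r, In r (root_indices css) -> has_root r x0 ->
    continuous01 (fun s => root_value r (gamma s))).
  { intros r Hr Hx s Hs eps Heps.
    destruct (path_nbhd n gamma s _ Hcont Hlen Hs
      (root_value_continuous n css C r (gamma s) eps Hcss HC Hr (HCg s Hs)
        (Hroot r x0 (gamma s) Hr Hx0 (HCg s Hs) Hx) Heps)) as [d [Hd H]].
    exists d. auto. }
  destruct (classic (exists r, In r (root_indices css) /\ has_root r x0 /\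
    root_value r x0 = y0)) as [(r & Hr & Hrx & <-)|Hne].
  - exists (fun s => root_value r (gamma s)).
    split; [exact Hcont|]. split; [now apply Hval|]. split; [now rewrite G0|]. split.
    (* The start is neither above nor below this root, so the end is not either, and [y1] is the
       root value over [x1]. *)
    + rewrite G1. f_equal. destruct (Hpos r Hr) as [Ha Hb].
      unfold above_root, below_root in Ha, Hb. simpl in Ha, Hb.
      pose proof (Hroot r x0 x1 Hr Hx0 Hx1 Hrx).
      destruct (Rtotal_order (root_value r x1) y1) as [H1|[H1|H1]]; [|exact H1|].
      * destruct (proj2 Ha (conj H H1)). lra.
      * destruct (proj2 Hb (conj H H1)). lra.
    + intros s Hs. split; [now apply HCg|]. intros r' Hr'.
      unfold above_root, below_root. simpl.
      split; split; intros [H1 H2]; (split; [eapply Hroot; eauto|]).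
      * apply (delineated_order n css C r' r x0 (gamma s)); auto.
      * apply (delineated_order n css C r' r (gamma s) x0); auto. eapply Hroot; eauto.
      * apply (delineated_order n css C r r' x0 (gamma s)); auto.
      * apply (delineated_order n css C r r' (gamma s) x0); auto. eapply Hroot; eauto.
  (* Each root existing over [x0] falls into exactly one of the classes [low] and [high] below,
     since [y0] is no root value. *)
  - set (sel := fun P : root_index -> Prop =>
      filter (fun r => if excluded_middle_informative (P r) then true else false)
        (root_indices css)).
    assert (Hsel : forall P r, In r (sel P) <-> In r (root_indices css) /\ P r).
    { intros P r. unfold sel. rewrite filter_In.
      destruct (excluded_middle_informative (P r)); intuition discriminate. }
    set (fcts := map (fun r s => root_value r (gamma s))).
    assert (Hfct : forall P f, (forall r, P r -> has_root r x0) ->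
      In f (fcts (sel P)) <-> exists r, (fun s => root_value r (gamma s)) = f /\
        In r (root_indices css) /\ P r).
    { intros P f _. unfold fcts. rewrite in_map_iff.
      split; intros (r & Hr & H); exists r; (split; [exact Hr|]); now apply Hsel. }
    set (low := fun r => above_root r (y0 :: x0)).
    set (high := fun r => below_root r (y0 :: x0)).
    assert (Hcontf : forall P, (forall r, P r -> has_root r x0) ->
      Forall continuous01 (fcts (sel P))).
    { intros P HP. apply Forall_forall. intros f Hf. apply Hfct in Hf; [|exact HP].
      destruct Hf as (r & <- & Hr & Hp). apply Hval; auto. }
    assert (Hlow : forall r, low r -> has_root r x0) by (intros r [H _]; exact H).
    assert (Hhigh : forall r, high r -> has_root r x0) by (intros r [H _]; exact H).
    destruct (continuous_interpolation (fcts (sel low)) (fcts (sel high)) y0 y1)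
      as (y & Hy & Y0 & Y1 & Hbetween); [now apply Hcontf|now apply Hcontf| | | |].
    + intros l u s Hl Hu Hs. apply Hfct in Hl, Hu; [|assumption..].
      destruct Hl as (r & <- & Hr & [Hrx Hlt]). destruct Hu as (r' & <- & Hr' & [Hrx' Hlt']).
      simpl in *. apply (delineated_order n css C r r' x0 (gamma s)); auto. lra.
    + intros l Hl. apply Hfct in Hl; [|assumption]. destruct Hl as (r & <- & Hr & Hp).
      rewrite G0, G1. split; [apply Hp|]. apply (Hpos r Hr), Hp.
    + intros u Hu. apply Hfct in Hu; [|assumption]. destruct Hu as (r & <- & Hr & Hp).
      rewrite G0, G1. split; [apply Hp|]. apply (Hpos r Hr), Hp.
    + exists y. split; [exact Hcont|]. split; [exact Hy|].
      split; [now rewrite Y0, G0|]. split; [now rewrite Y1, G1|].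
      intros s Hs. split; [now apply HCg|]. intros r Hr.
      destruct (Hbetween s Hs) as [B1 B2].
      assert (L1 : low r -> root_value r (gamma s) < y s).
      { intros H. apply (B1 (fun s => root_value r (gamma s))). apply Hfct; [assumption|].
        now exists r. }
      assert (L2 : high r -> y s < root_value r (gamma s)).
      { intros H. apply (B2 (fun s => root_value r (gamma s))). apply Hfct; [assumption|].
        now exists r. }
      assert (Htri : has_root r x0 -> low r \/ high r).
      { intros H. destruct (Rtotal_order (root_value r x0) y0) as [H1|[H1|H1]].
        - left. now split.
        - elim Hne. now exists r.
        - right. now split. }
      change (above_root r (y0 :: x0)) with (low r).
      change (below_root r (y0 :: x0)) with (high r).
      unfold above_root, below_root. simpl.
      assert (Hback : has_root r (gamma s) -> has_root r x0).
      { intros H. apply (Hroot r (gamma s)); auto. }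
      assert (Hforth : has_root r x0 -> has_root r (gamma s)).
      { intros H. apply (Hroot r x0); auto. }
      split; split.
      * intros H. split; auto.
      * intros [H1 H2]. destruct (Htri (Hback H1)) as [H|H]; [exact H|].
        specialize (L2 H). lra.
      * intros H. split; auto.
      * intros [H1 H2]. destruct (Htri (Hback H1)) as [H|H]; [|exact H].
        specialize (L1 H). lra.
Qed.

(** Unless [cs] vanishes on the whole fibre, [y0] is a simple root of [cs] or of one of its
    derivatives. Equal position puts [y1] on the same root function over [x1], and [del_vanish]
    makes [cs] vanish there too. *)
Lemma vanishing_constant n css C cs x0 y0 x1 y1 : delineated n css C -> In cs css ->
  C x0 -> C x1 -> same_position css (y0 :: x0) (y1 :: x1) ->
  upoly_at cs x0 y0 = 0 -> upoly_at cs x1 y1 = 0.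
Proof.
  intros HC Hcs Hx0 Hx1 Hpos H0.
  destruct (classic (forall y, upoly_at cs x0 y = 0)) as [Hz|Hz].
  - exact (del_zero n css C HC cs Hcs x0 x1 Hx0 Hx1 Hz y1).
  - destruct (root_simple_of_derivative cs x0 y0 H0) as (k & Hk & Hs).
    { apply not_all_ex_not. exact Hz. }
    destruct (simple_root_index _ 0 _ _ Hs I) as (i & _ & Hi).
    set (r := (Nat.iter k pderiv cs, i) : root_index).
    assert (Hr : In r (root_indices css)).
    { apply in_root_indices. exists cs, k. simpl. repeat split; auto.
      now apply nth_root_length in Hi. }
    destruct (del_vanish n css C HC cs r Hcs Hr x0 x1 Hx0 Hx1) as (y & Hy & Hy0).
    { now exists y0. }
    replace y1 with y; [exact Hy0|].
    pose proof (root_value_eq r x0 y0 Hi) as E0. pose proof (root_value_eq r x1 y Hy) as E1.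
    destruct (Hpos r Hr) as [Ha Hb]. unfold above_root, below_root in Ha, Hb. simpl in Ha, Hb.
    assert (Hr1 : has_root r x1) by now exists y.
    destruct (Rtotal_order y y1) as [H|[H|H]]; [|exact H|].
    + rewrite <- E1 in H. destruct (proj2 Ha (conj Hr1 H)). lra.
    + rewrite <- E1 in H. destruct (proj2 Hb (conj Hr1 H)). lra.
Qed.

Lemma same_position_sym css e e' : same_position css e e' -> same_position css e' e.
Proof. intros H r Hr. destruct (H r Hr). tauto. Qed.

(** A negative value at the end would force a zero somewhere on the lifted path; that point has the
    position of the start, so the zero would transfer to the start. *)
Lemma positivity_constant n css C cs x0 y0 x1 y1 : Forall (Forall polynomial_function) css ->
  delineated n css C -> In cs css ->
  C x0 -> C x1 -> same_position css (y0 :: x0) (y1 :: x1) ->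
  upoly_at cs x0 y0 > 0 -> upoly_at cs x1 y1 > 0.
Proof.
  intros Hcss HC Hcs Hx0 Hx1 Hpos H0.
  destruct (Rtotal_order (upoly_at cs x1 y1) 0) as [H1|[H1|H1]]; [exfalso| |exact H1].
  - destruct (lift_path n css C x0 y0 x1 y1 Hcss HC Hx0 Hx1 Hpos)
      as (gamma & y & Hg & Hy & E0 & E1 & Hs).
    injection E0 as Y0 G0. injection E1 as Y1 G1.
    pose (f := fun e => upoly_at cs (tl e) (hd 0 e)).
    assert (Hf : polynomial_function f).
    { apply pf_upoly_at; [|apply pf_tail|apply pf_hd].
      now apply (proj1 (Forall_forall _ css) Hcss). }
    destruct (ivt01 (fun s => f (y s :: gamma s))) as (s & Hs01 & Hs0).
    + apply (continuous01_along_path (S n)); [now apply cont_on_01_cons| |exact Hf].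
      intros s H. simpl. f_equal. apply (del_length n css C HC). now apply Hs.
    + unfold f. simpl. now rewrite Y0, G0.
    + unfold f. simpl. now rewrite Y1, G1.
    + destruct (Hs s Hs01) as [HCs HPs]. unfold f in Hs0. simpl in Hs0.
      pose proof (vanishing_constant n css C cs (gamma s) (y s) x0 y0 HC Hcs HCs Hx0
        (same_position_sym _ _ _ HPs) Hs0). lra.
  - pose proof (vanishing_constant n css C cs x1 y1 x0 y0 HC Hcs Hx1 Hx0
      (same_position_sym _ _ _ Hpos) H1). lra.
Qed.

Definition cylinder (C K : list R -> Prop) (e : list R) : Prop :=
  exists y x, e = y :: x /\ C x /\ K e.

(** The constancy fields of [delineated], in the same order, as a list to which the decomposition in
    lower dimension applies. *)
Definition delineating_predicates (css : list (list (list R -> R))) : list (list R -> Prop) :=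
  let L := root_indices css in
  map has_root L ++
  flat_map (fun r => map (fun r' x => exists y y', y < y' /\
      nth_root (fst r) (snd r) x y /\ nth_root (fst r') (snd r') x y') L) L ++
  flat_map (fun cs => map (fun r x =>
      exists y, nth_root (fst r) (snd r) x y /\ upoly_at cs x y = 0) L) css ++
  map (fun cs x => forall y, upoly_at cs x y = 0) css.

Lemma delineating_predicates_definable css : Forall (Forall polynomial_function) css ->
  Forall definable (delineating_predicates css).
Proof.
  intros Hcss. apply Forall_forall. intros P HP. unfold delineating_predicates in HP.
  assert (Hcs : forall cs, In cs css -> Forall polynomial_function cs)
    by apply (proj1 (Forall_forall _ css) Hcss).
  assert (Hr : forall r, In r (root_indices css) -> Forall polynomial_function (fst r))
    by (intros r; now apply root_indices_pf).
  assert (Htl : pf_list (@tl R)) by apply pf_tail.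
  apply in_app_or in HP. destruct HP as [HP|HP]; [|apply in_app_or in HP; destruct HP as [HP|HP];
    [|apply in_app_or in HP; destruct HP as [HP|HP]]].
  - apply in_map_iff in HP. destruct HP as (r & <- & HrL).
    apply definable_ex, definable_nth_root; auto using pf_hd.
  - apply in_flat_map in HP. destruct HP as (r & HrL & HP).
    apply in_map_iff in HP. destruct HP as (r' & <- & HrL').
    assert (Htl2 : pf_list (fun x : list R => tl (tl x))) by exact (pf_list_tl _ Htl).
    assert (Hhd : polynomial_function (fun x => hd 0 (tl x))) by exact (pf_tl _ pf_hd).
    do 2 apply definable_ex.
    apply definable_and; [|apply definable_and].
    + apply definable_lt; auto using pf_hd.
    + apply (definable_nth_root (fst r) (snd r) (fun x => tl (tl x)) (fun x => hd 0 (tl x))); auto.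
    + apply (definable_nth_root (fst r') (snd r') (fun x => tl (tl x)) (hd 0)); auto using pf_hd.
  - apply in_flat_map in HP. destruct HP as (cs & HcsL & HP).
    apply in_map_iff in HP. destruct HP as (r & <- & HrL).
    apply definable_ex, definable_and; [apply definable_nth_root; auto using pf_hd|].
    apply definable_eq; [apply pf_upoly_at; auto using pf_hd|apply pf_const].
  - apply in_map_iff in HP. destruct HP as (cs & <- & HcsL).
    apply definable_all, definable_eq; [apply pf_upoly_at; auto using pf_hd|apply pf_const].
Qed.

Lemma delineated_intro n css C : (forall x, C x -> length x = n) -> path_connected n C ->
  (forall P, In P (delineating_predicates css) -> constant_on C P) -> delineated n css C.
Proof.
  intros Hlen Hpath H. unfold delineating_predicates in H.
  constructor; [exact Hlen|exact Hpath| | | |].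
  - intros r Hr. apply H. apply in_or_app. left. now apply in_map.
  - intros r r' Hr Hr'. apply H. apply in_or_app. right. apply in_or_app. left.
    apply in_flat_map. exists r. split; [exact Hr|].
    apply in_map_iff. exists r'. now split.
  - intros cs r Hcs Hr. apply H. do 2 (apply in_or_app; right). apply in_or_app. left.
    apply in_flat_map. exists cs. split; [exact Hcs|].
    apply in_map_iff. exists r. now split.
  - intros cs Hcs. apply H. do 3 (apply in_or_app; right).
    apply in_map_iff. exists cs. now split.
Qed.

(** Over each delineated set, a cell prescribes the position relative to all root functions. Lifted
    paths stay within it, and position determines the signs. *)
Lemma cylindrical_step n css :
  (forall Ps, Forall definable Ps -> decomposable n Ps) ->
  Forall (Forall polynomial_function) css ->
  decomposable (S n) (flat_map (fun cs =>
    [(fun e => upoly_at cs (tl e) (hd 0 e) = 0); (fun e => upoly_at cs (tl e) (hd 0 e) > 0)]) css).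
Proof.
  intros IH Hcss.
  destruct (IH _ (delineating_predicates_definable css Hcss)) as (Cs & Hcov & HCs).
  destruct (separating_cells (map above_root (root_indices css) ++
    map below_root (root_indices css))) as (Ks & HKcov & HKs).
  assert (HK : forall K, In K Ks -> forall e, K e -> forall e', K e' <-> same_position css e e').
  { intros K HKin e He e'. rewrite (HKs K HKin e He e'). split.
    - intros H r Hr. split; apply H; apply in_or_app; [left|right]; now apply in_map.
    - intros H P HP. apply in_app_or in HP.
      destruct HP as [HP|HP]; apply in_map_iff in HP; destruct HP as (r & <- & Hr);
        now apply (H r Hr). }
  exists (flat_map (fun C => map (cylinder C) Ks) Cs). split.
  - intros [|y x] Hlen; [discriminate|]. injection Hlen as Hlen.
    destruct (Hcov x Hlen) as (C & HCin & HCx).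
    destruct (HKcov (y :: x)) as (K & HKin & HKe).
    exists (cylinder C K). split.
    + apply in_flat_map. exists C. split; [exact HCin|]. now apply in_map.
    + now exists y, x.
  - intros D HD. apply in_flat_map in HD. destruct HD as (C & HCin & HD).
    apply in_map_iff in HD. destruct HD as (K & <- & HKin).
    destruct (HCs C HCin) as (Hlen & Hpath & Hconst).
    pose proof (delineated_intro n css C Hlen Hpath Hconst) as HC.
    split; [|split].
    + intros e (y & x & -> & Hx & _). simpl. f_equal. now apply Hlen.
    + intros e e' (y0 & x0 & -> & Hx0 & HK0) (y1 & x1 & -> & Hx1 & HK1).
      assert (Hpos := proj1 (HK K HKin _ HK0 _) HK1).
      destruct (lift_path n css C x0 y0 x1 y1 Hcss HC Hx0 Hx1 Hpos)
        as (gamma & y & Hg & Hy & E0 & E1 & Hs).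
      exists (fun s => y s :: gamma s). split; [now apply cont_on_01_cons|].
      split; [|now split]. intros s H01. destruct (Hs s H01) as [HCs' HPs].
      exists (y s), (gamma s). split; [reflexivity|]. split; [exact HCs'|].
      now apply (HK K HKin _ HK0).
    + intros P HP e e' (y0 & x0 & -> & Hx0 & HK0) (y1 & x1 & -> & Hx1 & HK1).
      assert (Hpos := proj1 (HK K HKin _ HK0 _) HK1).
      apply in_flat_map in HP. destruct HP as (cs & Hcs & [<-|[<-|[]]]); simpl.
      * now apply (vanishing_constant n css C).
      * now apply (positivity_constant n css C).
Qed.

(** * From sign conditions to path components *)

Fixpoint atoms (F : sa_formula) : list mpoly :=
  match F with
  | SAEq0 P | SAGt0 P => [P]
  | SAOr F G | SAAnd F G => atoms F ++ atoms G
  | SANot F => atoms F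
  end.

Lemma sa_holds_atoms F x x' :
  (forall P, In P (atoms F) -> (mpoly_eval x P = 0 <-> mpoly_eval x' P = 0) /\
     (mpoly_eval x P > 0 <-> mpoly_eval x' P > 0)) ->
  sa_holds x F <-> sa_holds x' F.
Proof.
  induction F as [P|P|F IHF G IHG|F IHF G IHG|F IHF]; simpl; intros H.
  - apply (H P). now left.
  - apply (H P). now left.
  - rewrite IHF, IHG; [reflexivity| |]; intros P HP; apply H, in_or_app; auto.
  - rewrite IHF, IHG; [reflexivity| |]; intros P HP; apply H, in_or_app; auto.
  - rewrite IHF; [reflexivity|exact H].
Qed.

Theorem decomposition n Ps : Forall definable Ps -> decomposable n Ps.
Proof.
  revert Ps. induction n as [|n IH]; intros Ps HPs.
  - exists [fun x => x = []]. split.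
    + intros x Hx. exists (fun x => x = []). split; [now left|].
      now apply length_zero_iff_nil.
    + intros C [<-|[]]. split; [now intros x ->|]. split.
      * intros x x' -> ->. exists (fun _ => []). repeat split.
        intros i Hi. lia.
      * now intros P _ x x' -> ->.
  (* The polynomials occurring in the formulas of [Ps], read in their first variable: their signs
     decide every member of [Ps]. *)
  - assert (Hcss : exists css, Forall (Forall polynomial_function) css /\
      forall P, In P Ps -> forall x x' y y',
        (forall cs, In cs css -> (upoly_at cs x y = 0 <-> upoly_at cs x' y' = 0) /\
           (upoly_at cs x y > 0 <-> upoly_at cs x' y' > 0)) -> P (y :: x) -> P (y' :: x')).
    { induction HPs as [|P Ps [F HF] HPs (css & Hcss & Hc)].
      - exists []. split; [constructor|]. contradiction.
      - assert (HFa : exists css', Forall (Forall polynomial_function) css' /\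
          forall Q, In Q (atoms F) -> exists cs, In cs css' /\
            forall y x, mpoly_eval (y :: x) Q = upoly_at cs x y).
        { induction (atoms F) as [|Q Qs (css' & Hcss' & Hc')].
          - exists []. split; [constructor|]. contradiction.
          - destruct (polynomial_in_first_variable _ (pf_mpoly Q)) as (cs & Hcs & E).
            exists (cs :: css'). split; [now constructor|]. intros Q' [<-|HQ'].
            + exists cs. split; [now left|exact E].
            + destruct (Hc' Q' HQ') as (cs' & Hin & E'). exists cs'.
              split; [now right|exact E']. }
        destruct HFa as (css' & Hcss' & Hc'). exists (css' ++ css).
        split; [now apply Forall_app|]. intros P' [<-|HP'] x x' y y' Hsgn.
        + rewrite !HF. refine (proj1 (sa_holds_atoms F (y :: x) (y' :: x') _)). intros Q HQ.
          destruct (Hc' Q HQ) as (cs & Hin & E). rewrite !E. apply Hsgn, in_or_app. now left.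
        + apply (Hc P' HP'). intros cs Hin. apply Hsgn, in_or_app. now right. }
    destruct Hcss as (css & Hcss & Hc).
    destruct (cylindrical_step n css IH Hcss) as (Cs & Hcov & HCs).
    exists Cs. split; [exact Hcov|]. intros C HCin.
    destruct (HCs C HCin) as (Hlen & Hpath & Hconst).
    split; [exact Hlen|]. split; [exact Hpath|].
    intros P HP e e' He He'.
    assert (Hsgn : forall cs, In cs css -> forall e e', C e -> C e' ->
      (upoly_at cs (tl e) (hd 0 e) = 0 -> upoly_at cs (tl e') (hd 0 e') = 0) /\
      (upoly_at cs (tl e) (hd 0 e) > 0 -> upoly_at cs (tl e') (hd 0 e') > 0)).
    { intros cs Hcs e1 e2 H1 H2. split.
      - apply (Hconst (fun e => upoly_at cs (tl e) (hd 0 e) = 0)); auto.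
        apply in_flat_map. exists cs. split; [exact Hcs|now left].
      - apply (Hconst (fun e => upoly_at cs (tl e) (hd 0 e) > 0)); auto.
        apply in_flat_map. exists cs. split; [exact Hcs|right; now left]. }
    pose proof (Hlen e He) as Le. pose proof (Hlen e' He') as Le'.
    destruct e as [|y x]; [discriminate|]. destruct e' as [|y' x']; [discriminate|].
    apply (Hc P HP). intros cs Hcs.
    pose proof (Hsgn cs Hcs _ _ He He') as [A1 A2].
    pose proof (Hsgn cs Hcs _ _ He' He) as [B1 B2]. simpl in *. tauto.
Qed.

(** Each cell lies inside [S] or misses it, so the paths of a cell meeting [S] stay in [S], and one
    point per such cell is enough. *)
Theorem semialgebraic_finitely_many_path_components n S :
  semialgebraic n S -> finitely_many_path_components n S.
Proof.
  intros [Hlen [F HF]].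
  destruct (decomposition n [fun x => sa_holds x F]) as (Cs & Hcov & HCs).
  { constructor; [now exists F|constructor]. }
  assert (HS : forall C, In C Cs -> forall x x', C x -> C x' -> S x -> S x').
  { intros C HC x x' Hx Hx' HSx. destruct (HCs C HC) as (HCl & _ & Hconst).
    apply HF; [now apply HCl|].
    apply (Hconst (fun x => sa_holds x F) (or_introl eq_refl) x x' Hx Hx').
    apply HF; [now apply HCl|exact HSx]. }
  (* Covering is required point by point here, so that the induction can remove cells from the
     list. *)
  assert (Hreps : exists L, (forall z, In z L -> S z) /\ forall x, S x ->
    (exists C, In C Cs /\ C x) -> exists z, In z L /\ path_connected_in n S x z).
  { clear Hcov. induction Cs as [|C Cs IH].
    - exists []. split; [easy|]. intros x _ (C & [] & _).
    - destruct IH as (L & HL & Hc).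
      { intros C' HC'. apply HCs. now right. }
      { intros C' HC'. apply HS. now right. }
      destruct (classic (exists z, C z /\ S z)) as [(z & HCz & HSz)|Hno].
      + exists (z :: L). split; [intros z' [<-|Hz']; auto|].
        intros x Hx (C' & [<-|HC'] & HCx).
        * exists z. split; [now left|].
          destruct (HCs C (or_introl eq_refl)) as (_ & Hpath & _).
          destruct (Hpath x z HCx HCz) as (gamma & Hg & HCg & G).
          exists gamma. split; [exact Hg|]. split; [|exact G].
          intros s Hs. apply (HS C (or_introl eq_refl) x); auto.
        * destruct (Hc x Hx) as (w & Hw & Hp); [now exists C'|].
          exists w. split; [now right|exact Hp].
      + exists L. split; [exact HL|]. intros x Hx (C' & [<-|HC'] & HCx).
        * elim Hno. now exists x.
        * apply (Hc x Hx). now exists C'. }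
  destruct Hreps as (L & HL & Hc). exists L. split; [exact HL|].
  intros x Hx. apply (Hc x Hx). apply Hcov. now apply Hlen.
Qed.

(** As [eta] is a homeomorphism onto its image, the path components of the space of knots are
    counted in that image. *)
Theorem mainTheorem9 : forall d : nat, (2 <= d)%nat ->
  semialgebraic (3 * d) (eta_O d) /\
  finitely_many_path_components (3 * d) (eta_O d).
Proof.
  intros d Hd. assert (H : semialgebraic (3 * d) (eta_O d)).
  { split; [|now apply eta_O_formula]. intros x Hx. now apply eta_O_iff in Hx. }
  split; [exact H|]. now apply semialgebraic_finitely_many_path_components.
Qed.
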